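(* Let $T>0$, $p\ge \frac13$, $c\in\mathbb{R}$, and let $e$ be a $T$-periodic function with $e\in L^2(0,T)$ and $\int_0^T e(t)\,dt=0$. For $\mu\in\mathbb{R}$ consider the problem $$u''(t)+c\,u'(t)+\frac{1}{u^p(t)}=\mu+e(t),\qquad u(t+T)=u(t).\qquad ( * )$$ Then $( * )$ has a unique positive $T$-periodic solution $u\in W^{2,2}(0,T)$ if and only if $\mu>0$. Moreover, write each positive $T$-periodic solution as $u(t)=\xi+U(t)$ with $\xi\in\mathbb{R}$ and $\int_0^T U(t)\,dt=0$. Then $\xi$ is a global parameter: the value of $\xi$ uniquely identifies the solution pair $(u(t),\mu)$. All positive $T$-periodic solutions lie on a unique (hyperbola-like) curve $\mu=\varphi(\xi)$; that is, the set of pairs $(\xi,\mu)$ arising from positive $T$-periodic solutions of $( * )$ is the graph of a function $\varphi$. The function $\varphi$ is continuous and decreasing, it is defined for $\xi\in(\xi_0,\infty)$ with some $\xi_0\ge 0$, and $$\lim_{\xi\to \xi_0}\varphi(\xi)=\infty,\qquad \lim_{\xi\to\infty}\varphi(\xi)=0 .$$ If, moreover, $p\le 1$ (i.e. $\frac13\le p\le 1$), then $\xi_0=0$.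
   Context: Solutions are strong solutions: $T$-periodic functions $u$ on $\mathbb{R}$ belonging to $H^2_T$ (locally $W^{2,2}$ and $T$-periodic, so that $u$ and $u'$ are continuous and $T$-periodic), satisfying the equation for almost every $t$. Positive means $u(t)>0$ for all $t$. A solution pair is $(u,\mu)$ with $\mu\in\mathbb{R}$ and $u$ a positive $T$-periodic solution of $( * )$ for that $\mu$. The number $\xi=\frac1T\int_0^T u(t)\,dt$ is the average of $u$. ''Hyperbola-like'' is only a descriptive word for the listed properties of $\varphi$. *)

(* Defs.v *)
From HB Require Import structures.
From mathcomp Require Import all_boot all_order all_algebra.
From mathcomp Require Import all_classical all_reals all_analysis.

Set Implicit Arguments.
Unset Strict Implicit.
Unset Printing Implicit Defensive.

Import Order.TTheory GRing.Theory Num.Theory.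
Import numFieldNormedType.Exports.

Local Open Scope classical_set_scope.
Local Open Scope ring_scope.

Section PeriodicProblem.
Context {R : realType}.
Implicit Types (T p c m xi a b : R) (e f g u v w phi : R -> R).

Local Notation leb := (@lebesgue_measure R).

(* [f \_ D] vanishes outside D: [point] is 0 in R. *)
Definition L2_on (D : set R) f := f \_ D \in Lfun leb 2%:E.

Definition L2_loc f := forall a b, L2_on `[a, b]%classic f.

Definition C1_compact_support phi :=
  [/\ forall x, derivable phi x 1,
      continuous (derive1 phi)
    & compact (closure [set x | phi x != 0])].

(* C^1 test functions with compact support, as in H. Brezis, "Functional
   Analysis, Sobolev Spaces and Partial Differential Equations", section 8.2.
   Local integrability makes both integrals below genuine ([Rintegral] is a
   total operator). *)
Definition weak_derivative f g :=
  [/\ locally_integrable setT f,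
      locally_integrable setT g
    & forall phi, C1_compact_support phi ->
        \int[leb]_x (f x * derive1 phi x) = - \int[leb]_x (g x * phi x)].

Definition W22_loc u v w :=
  [/\ weak_derivative u v, weak_derivative v w,
      L2_loc u, L2_loc v & L2_loc w].

(* [H2_periodic T u v w]: u is in H^2_T, with weak derivatives u' = v and
   u'' = w. Elements of W^{2,2} are classes modulo a.e. equality; continuity
   of u selects the continuous representative. *)
Definition H2_periodic T u v w :=
  [/\ W22_loc u v w, continuous u & periodic u T].

Definition positive_solution T p c e m u :=
  (forall t, 0 < u t) /\
  exists v w, H2_periodic T u v w /\
    {ae leb, forall t, w t + c * v t + (u t `^ p)^-1 = m + e t}.

Definition average T u : R := T^-1 * \int[leb]_(t in `[0, T]) u t.

End PeriodicProblem.

(* Main.v *)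
Require Import Defs.
From HB Require Import structures.
From mathcomp Require Import all_boot all_order all_algebra.
From mathcomp Require Import all_classical all_reals all_analysis.
From mathcomp Require Import measurable_realfun ring lra.

Set Implicit Arguments.
Unset Strict Implicit.
Unset Printing Implicit Defensive.

Import Order.TTheory GRing.Theory Num.Theory.
Import numFieldNormedType.Exports.

Local Open Scope classical_set_scope.
Local Open Scope ring_scope.

(** Write E for the primitive of e that vanishes at 0. It is continuous, and
    T-periodic because e has mean zero. With z = u' + c u - E the equation
    becomes the first-order system

      u' = z + E - c u,      z' = mu - u^-p,

    whose right-hand sides are continuous: [classical_solution]. The passage
    between this system and the weak formulation is an integration by parts
    against the rough function e ([prim_by_parts]) in one direction and the
    du Bois-Reymond lemma ([du_bois_reymond]) in the other. From then on all
    arguments concern C^1 functions.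

    Uniqueness and monotonicity. Since s |-> s^-p decreases, the difference of
    two solutions cannot have a positive maximum ([maximum_principle],
    [comparison]). Hence a solution is determined by mu and decreases pointwise
    as mu increases; two solutions with the same average coincide, and so do
    their mu. Shifting a solution by a small constant gives a sub- and a
    supersolution for all nearby mu, hence continuous dependence on mu
    ([solution_near]). Integrating z' over a period shows mu > 0.

    Existence. Extend s^-p from a segment [eps, M] to a C^1 function g on the
    line with slopes between two negative constants ([tame]). For g the problem
    is solved by a contraction in the sup norm on periodic functions
    ([semilinear_existence]). The solution lies in [eps, M], and therefore
    solves the original equation, thanks to three estimates that depend neither
    on eps nor on M:
      - testing with u - a, where g a = mu, gives the bound of [slope_estimate]
        on the L^2 norm of u', hence bounded oscillation ([oscillation]);
      - testing with g(u) - mu bounds the L^2 norm of g(u) - mu by that of e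
        ([curvature_estimate]);
      - both make u' Holder continuous of exponent 1/2, so near its minimum u
        exceeds it by at most a multiple of s^(3/2) at distance s. Were the
        minimum close to 0, then g(u)^2 would be of size s^(-3p), at least 1/s
        because p >= 1/3, and its integral would be too large
        ([positivity_of_minimum]).

    The curve. The average xi(mu) is continuous and strictly decreasing, and
    it is unbounded as mu tends to 0 because u >= mu^(-1/p) - const
    ([solution_lower]). So phi is its inverse, and xi_0 its infimum
    ([inverse_branch]). For p <= 1, testing with u bounds (mu - 1) xi(mu), so
    that the infimum is 0 ([solution_mean_bound]). *)

Local Notation leb := lebesgue_measure.
Local Notation locint := (locally_integrable [set: _]).
Local Notation derives f df :=
  (forall x : Real.sort _, is_derive x 1 f (df x)).

(** * Primitives of locally integrable functions *)

Section Primitive.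
Context {R : realType}.
Implicit Types (f g : R -> R) (a b x y : R).

Lemma locint_integrable f a b : locint f ->
  leb.-integrable `[a, b] (EFin \o f).
Proof.
move=> [mf _ fK]; apply/integrableP; split.
  by apply/measurable_EFinP; exact: measurable_funS mf.
by apply: fK => //; exact: segment_compact.
Qed.

Lemma integrable_locint f : measurable_fun setT f ->
  (forall a b, leb.-integrable `[a, b] (EFin \o f)) -> locint f.
Proof.
move=> mf fi; split => //; first exact: openT.
move=> K _ cK.
have [M [Mr KM]] := compact_bounded cK.
have := fi (- (M + 1)) (M + 1) => /integrableP[_]; apply: le_lt_trans.
apply: ge0_subset_integral => //=.
- exact: compact_measurable.
- apply/measurable_EFinP; apply: measurableT_comp => //.
  exact: measurable_funS mf.
- move=> x Kx /=; rewrite in_itv/= -ler_norml.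
  by apply: (KM (M + 1)) => //; rewrite ltrDl.
Qed.

Lemma continuous_locint f : continuous f -> locint f.
Proof.
move=> cf; apply: integrable_locint.
  exact: continuous_measurable_fun.
move=> a b; apply: continuous_compact_integrable.
  exact: segment_compact.
exact: continuous_subspaceT.
Qed.

Lemma locintM f g : continuous f -> locint g -> locint (fun x => f x * g x).
Proof.
move=> cf lg; apply: integrable_locint.
  apply: measurable_funM; first exact: continuous_measurable_fun.
  by case: lg.
move=> a b.
apply: (@integrableMr _ _ R leb `[a, b] _ f (EFin \o g)) => //.
- apply: measurable_funTS; exact: continuous_measurable_fun.
- have : compact (f @` `[a, b]).
    apply: continuous_compact; first exact: continuous_subspaceT.
    exact: segment_compact.
  move=> /compact_bounded[M [Mr KM]]; exists M; split => // r /KM H x abx.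
  by apply: H; exists x.
- exact: locint_integrable.
Qed.

Lemma locintZ f k : locint f -> locint (fun x => k * f x).
Proof. by move=> lf; apply: (@locintM (cst k)) => // x; exact: cvg_cst. Qed.

Lemma locint_norm f : locint f -> locint (fun x => `|f x|).
Proof.
move=> lf; apply: integrable_locint.
  by apply: measurableT_comp => //; case: lf.
move=> a b; have := integrable_norm (locint_integrable a b lf).
by [].
Qed.

(** The difference of two integrals, one of which is over an empty interval or a
    point, makes the formula right on both sides of 0. *)
Definition prim f x :=
  \int[leb]_(t in `[0, x]) f t - \int[leb]_(t in `[x, 0]) f t.

Lemma Rintegral_cat f a b x : locint f -> a <= b -> b <= x ->
  \int[leb]_(t in `[a, x]) f t =
  \int[leb]_(t in `[a, b]) f t + \int[leb]_(t in `[b, x]) f t.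
Proof.
move=> lf ab bx.
have := @Rintegral_itvB R f (BLeft a) (BRight x) b (locint_integrable _ _ lf).
rewrite !bnd_simp => /(_ ab bx) H.
rewrite -(Rintegral_itv_obnd_cbnd (r := b)).
  by rewrite -H addrC subrK.
apply: integrableS (locint_integrable a x lf) => //.
by apply: subset_itvr; rewrite bnd_simp.
Qed.

Lemma Rintegral_itv1 f a : \int[leb]_(t in `[a, a]) f t = 0.
Proof. by rewrite set_itv1 Rintegral_set1. Qed.

Lemma Rintegral_itv_le f a b : b <= a -> \int[leb]_(t in `[a, b]) f t = 0.
Proof.
rewrite le_eqVlt => /predU1P[->|ba]; first exact: Rintegral_itv1.
by rewrite set_itv_ge ?Rintegral_set0// bnd_simp -ltNge.
Qed.

Lemma prim_incr f a b : locint f -> a <= b ->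
  prim f b - prim f a = \int[leb]_(t in `[a, b]) f t.
Proof.
move=> lf ab; rewrite /prim.
have [a0|a0] := leP 0 a.
  rewrite (Rintegral_itv_le f a0) (Rintegral_itv_le f (le_trans a0 ab)) !subr0.
  by rewrite (Rintegral_cat lf a0 ab) addrC addKr.
have [b0|b0] := leP 0 b.
  rewrite (Rintegral_itv_le f (ltW a0))
    (Rintegral_itv_le f b0) subr0 sub0r opprK.
  by rewrite (Rintegral_cat lf (ltW a0) b0) addrC.
rewrite (Rintegral_itv_le f (ltW a0)) (Rintegral_itv_le f
  (ltW b0)) !sub0r opprK.
by rewrite (Rintegral_cat lf ab (ltW b0)) addrC addrK.
Qed.

Lemma prim0 f : prim f 0 = 0.
Proof. by rewrite /prim subrr. Qed.

Lemma primE f x : 0 <= x -> prim f x = \int[leb]_(t in `[0, x]) f t.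
Proof. by move=> x0; rewrite /prim (Rintegral_itv_le f x0) subr0. Qed.

Lemma prim_parameterized f a y : locint f -> a <= y ->
  prim f y = prim f a + parameterized_integral leb a y f.
Proof.
by move=> lf ay; rewrite /parameterized_integral -prim_incr// addrC subrK.
Qed.

Lemma continuous_prim f : locint f -> continuous (prim f).
Proof.
move=> lf x.
have ab : x - 1 < x + 1 by lra.
have := parameterized_integral_continuous (ltW ab) (locint_integrable _ _ lf).
move=> cI; have H := within_continuous_continuous ab cI.
have : {for x, continuous (fun y => parameterized_integral leb (x - 1) y f)}.
  by apply: H; rewrite in_itv/=; apply/andP; split; lra.
move=> H1.
have H2 : {for x, continuous (fun y => prim f (x - 1) +
   parameterized_integral leb (x - 1) y f)}.
  by apply: cvgD => //; exact: cvg_cst.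
rewrite /continuous_at (prim_parameterized (a := x - 1))//; last by lra.
apply: cvg_trans H2; apply: near_eq_cvg; near=> y.
apply/esym/prim_parameterized => //; apply/ltW; near: y.
by apply: lt_nbhsr; lra.
Unshelve. all: by end_near. Qed.

Lemma is_derive_prim f x : locint f -> {for x, continuous f} ->
  is_derive x 1 (prim f) (f x).
Proof.
move=> lf cf.
have xu : x < x + 1 by lra.
have ax : x - 1 < x by lra.
have [H1 H2] := continuous_FTC1_closed xu (locint_integrable (x-1) _ lf) ax cf.
have H : \forall y \near x, prim f y = prim f (x - 1) +
   parameterized_integral leb (x - 1) y f.
  near=> y; apply: prim_parameterized => //; apply/ltW; near: y.
  by apply: lt_nbhsr; lra.
have : is_derive x 1 (fun y => prim f (x - 1) +
   parameterized_integral leb (x - 1) y f) (f x).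
  rewrite -[f x]add0r; apply: is_deriveD.
  by apply: (DeriveDef H1); rewrite -derive1E; exact: H2.
apply: near_eq_is_derive.
by apply: filterS H => y ->.
Unshelve. all: by end_near. Qed.

End Primitive.

(** * Derivatives and mean values *)

Section RealDerivatives.
Context {R : realType}.
Implicit Types (f g df : R -> R) (a b x y : R).

Lemma derD f g x (df dg : R) : is_derive x 1 f df -> is_derive x 1 g dg ->
  is_derive x 1 (fun y => f y + g y) (df + dg).
Proof. by move=> ? ?; exact: is_deriveD. Qed.

Lemma derN f x (df : R) : is_derive x 1 f df ->
  is_derive x 1 (fun y => - f y) (- df).
Proof. by move=> ?; exact: is_deriveN. Qed.

Lemma derB f g x (df dg : R) : is_derive x 1 f df -> is_derive x 1 g dg ->
  is_derive x 1 (fun y => f y - g y) (df - dg).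
Proof. by move=> ? ?; exact: is_deriveB. Qed.

Lemma derM f g x (df dg : R) : is_derive x 1 f df -> is_derive x 1 g dg ->
  is_derive x 1 (fun y => f y * g y) (df * g x + f x * dg).
Proof.
move=> Df Dg; have := is_deriveM Df Dg.
by rewrite /GRing.scale/= addrC (mulrC (g x)).
Qed.

Lemma derC (k x : R) : is_derive x 1 (fun=> k) 0.
Proof. exact: is_derive_cst. Qed.

Lemma derZ f x (df k : R) : is_derive x 1 f df ->
  is_derive x 1 (fun y => k * f y) (k * df).
Proof.
by move=> Df; have := derM (derC k x) Df; rewrite mul0r add0r.
Qed.

Lemma derX x : is_derive x 1 id (1 : R).
Proof. exact: is_derive_id. Qed.

Lemma der_comp f g x (df dg : R) : is_derive x 1 f df ->
  is_derive (f x) 1 g dg ->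
  is_derive x 1 (fun y => g (f y)) (dg * df).
Proof. by move=> Df Dg; have := is_derive1_comp Dg Df. Qed.

Lemma der_eq f x (d1 d2 : R) : is_derive x 1 f d1 -> d1 = d2 ->
  is_derive x 1 f d2.
Proof. by move=> ? <-. Qed.

Lemma der_continuous f (df : R -> R) : (forall x, is_derive x 1 f (df x)) ->
  continuous f.
Proof.
move=> Df x; apply: differentiable_continuous.
by apply/derivable1_diffP; exact: ex_derive.
Qed.

Lemma derive_unique f x a b : is_derive x 1 f a -> is_derive x 1 f b -> a = b.
Proof. by case=> _ <- [_ <-]. Qed.

Lemma der_mvt f df a b : (forall x, a <= x <= b -> is_derive x 1 f (df x)) ->
  a < b ->
  exists2 c, a < c < b & f b - f a = df c * (b - a).
Proof.
move=> Df ab; have [||c] := @MVT R f df a b ab.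
- by move=> x; rewrite in_itv/= => /andP[ax xb]; apply: Df; rewrite !ltW.
- apply: derivable_within_continuous => x; rewrite in_itv/= => /Df D.
  exact: ex_derive.
- by rewrite in_itv/= => ? ?; exists c.
Qed.

(** Differentiability is assumed on the segment only: the comparison function
    used to bound the minimum of a solution is logarithmic. *)
Lemma der_le f df a b : (forall x, a <= x <= b -> is_derive x 1 f (df x)) ->
  (forall x, a <= x <= b -> 0 <= df x) -> a <= b -> f a <= f b.
Proof.
move=> Df df0; rewrite le_eqVlt => /predU1P[->//|ab].
have [x /andP[ax xb] E] := der_mvt Df ab.
by rewrite -subr_ge0 E mulr_ge0 ?subr_ge0 ?df0 ?ltW.
Qed.

Lemma der_lt f df a b : (forall x, is_derive x 1 f (df x)) ->
  (forall x, a < x < b -> 0 < df x) -> a < b -> f a < f b.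
Proof.
move=> Df df0 ab; have [x axb E] := der_mvt (fun x _ => Df x) ab.
by rewrite -subr_gt0 E mulr_gt0 ?subr_gt0 ?df0.
Qed.

Lemma der_cst f a b : (forall x, is_derive x 1 f 0) -> f a = f b.
Proof. by move=> Df; apply: is_derive_0_is_cst. Qed.

Lemma continuous_add f g : continuous f -> continuous g ->
  continuous (fun x => f x + g x).
Proof. by move=> cf cg x; apply: cvgD; [exact: cf|exact: cg]. Qed.

Lemma continuous_sub f g : continuous f -> continuous g ->
  continuous (fun x => f x - g x).
Proof. by move=> cf cg x; apply: cvgB; [exact: cf|exact: cg]. Qed.

Lemma continuous_opp f : continuous f -> continuous (fun x => - f x).
Proof. by move=> cf x; apply: cvgN; exact: cf. Qed.

Lemma continuous_mul f g : continuous f -> continuous g ->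
  continuous (fun x => f x * g x).
Proof. by move=> cf cg x; apply: cvgM; [exact: cf|exact: cg]. Qed.

Lemma continuous_const (k : R) : continuous (fun _ : R => k).
Proof. by move=> x; exact: cvg_cst. Qed.

Lemma continuous_scale k f : continuous f -> continuous (fun x => k * f x).
Proof. by move=> cf; apply: continuous_mul => //; exact: continuous_const. Qed.

Lemma continuous_compose f g : continuous f -> continuous g ->
  continuous (fun x => g (f x)).
Proof. by move=> cf cg x; apply: continuous_comp; [exact: cf|exact: cg]. Qed.

Lemma continuous_normf f : continuous f -> continuous (fun x => `|f x|).
Proof. by move=> cf x; apply: cvg_norm; exact: cf. Qed.

End RealDerivatives.

(** * Calculus of primitives and integration by parts *)

Section PrimCalculus.
Context {R : realType}.
Implicit Types (f g df : R -> R) (a b x y : R).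

Lemma primD f g x : locint f -> locint g ->
  prim (fun t => f t + g t) x = prim f x + prim g x.
Proof.
move=> lf lg; rewrite /prim !RintegralD//; try exact: locint_integrable.
by rewrite opprD addrACA.
Qed.

Lemma primZ k f x : locint f -> prim (fun t => k * f t) x = k * prim f x.
Proof.
move=> lf; rewrite /prim !RintegralZl//; try exact: locint_integrable.
by rewrite mulrBr.
Qed.

Lemma locintD f g : locint f -> locint g -> locint (fun x => f x + g x).
Proof. by move=> lf lg; exact: locally_integrableD. Qed.

Lemma locintB f g : locint f -> locint g -> locint (fun x => f x - g x).
Proof. by move=> lf lg; exact: locally_integrableB. Qed.

Lemma primB f g x : locint f -> locint g ->
  prim (fun t => f t - g t) x = prim f x - prim g x.
Proof.
move=> lf lg; rewrite /prim !RintegralB//; try exact: locint_integrable.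
by rewrite !opprB addrACA [in RHS]addrC addrA addrACA [- _ + _]addrC [in
  LHS]addrC; ring.
Qed.

Lemma prim_le f g a b : locint f -> locint g -> a <= b ->
  (forall x, a <= x <= b -> f x <= g x) ->
  prim f b - prim f a <= prim g b - prim g a.
Proof.
move=> lf lg ab fg; rewrite !prim_incr//; by apply: le_Rintegral => //;
  exact: locint_integrable.
Qed.

Lemma prim_norm f a b : locint f -> a <= b ->
  `|prim f b - prim f a| <= prim (fun x => `|f x|) b - prim (fun x => `|f x|) a.
Proof.
move=> lf ab; rewrite !prim_incr//; last exact: locint_norm.
by apply: le_normr_Rintegral => //; exact: locint_integrable.
Qed.

Lemma prim_cst k x : prim (fun=> k : R) x = k * x.
Proof.
have ck := @continuous_const R k.
have := @der_cst R (fun y => prim (fun=> k) y - k * y) x 0.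
rewrite prim0 mulr0 subr0 => H; apply/eqP; rewrite -subr_eq0; apply/eqP/H => y.
apply: der_eq (derB (is_derive_prim (continuous_locint ck) (ck y)) (derZ k
  (derX y))) _.
by rewrite mulr1 subrr.
Qed.

Lemma prim_der F f a b : (forall x, is_derive x 1 F (f x)) -> continuous f ->
  prim f b - prim f a = F b - F a.
Proof.
move=> DF cf.
have H : prim f b - F b = prim f a - F a.
  apply: (@der_cst R (fun y => prim f y - F y)) => x.
  apply: der_eq (derB (is_derive_prim (continuous_locint cf) (cf x)) (DF x)) _.
  by rewrite subrr.
lra.
Qed.

Lemma continuous_near_le (f : R -> R) (x e : R) : continuous f -> 0 < e ->
  \forall y \near x, `|f x - f y| <= e.
Proof. by move=> cf e0; move: (cf x) => /cvgrPdist_le; apply. Qed.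

(** The derivative is 0 as soon as increments are o(|y - x|); this form suits
    functions known through integral bounds. *)
Lemma der0_near (F : R -> R) (x : R) :
  (forall e : R, 0 < e -> \forall y \near x, `|F y - F x| <= e * `|y - x|) ->
  is_derive x 1 F 0.
Proof.
move=> H.
have C : (fun h : R => h^-1 *: ((F \o shift x) (h *: 1) - F x)) @ 0^' -->
  (0 : R).
  apply/cvgrPdist_le => e e0.
  have := H e e0 => /nbhs_ballP[d /= d0 Hd].
  exists d => //= h /=; rewrite sub0r normrN => hd h0.
  have : `|F (h + x) - F x| <= e * `|h + x - x|.
    by apply: Hd; rewrite /ball/= opprD addrCA subrr addr0 normrN.
  rewrite addrK /shift/= [_ *: 1]mulr1 => Hh.
  rewrite sub0r normrN normrZ normfV mulrC ler_pdivrMr ?normr_gt0//.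
apply: DeriveDef; first exact: cvgP C.
exact: cvg_lim C.
Qed.

Lemma prim_bound f g a b : locint f -> locint g ->
  (forall t, Num.min a b <= t <= Num.max a b -> `|f t| <= g t) ->
  `|prim f b - prim f a| <= `|prim g b - prim g a|.
Proof.
move=> lf lg.
wlog ab : a b / a <= b.
  move=> W; have [|ba] := orP (le_total a b); first exact: W.
  by rewrite minC maxC => H; rewrite distrC [leRHS]distrC; exact: W.
rewrite (min_l ab) (max_r ab) => fg.
apply: (le_trans (prim_norm lf ab)); apply: le_trans (ler_norm _).
by apply: prim_le => //; exact: locint_norm.
Qed.

(** Although [prim e] is only continuous, the difference of the two sides has
    derivative 0 everywhere. Its increment from x to y is the integral of
    dphi * (E - E y) + (phi - phi x) * e, which is o(|y - x|): the first term by
    continuity of E, the second because phi is Lipschitz near x and the primitive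
    of |e| is continuous. *)
Lemma prim_by_parts (e phi dphi : R -> R) (x : R) : locint e ->
  derives phi dphi -> continuous dphi ->
  prim (fun t => dphi t * prim e t + phi t * e t) x = phi x * prim e x.
Proof.
move=> e_loc Dphi cdphi.
have cphi := der_continuous Dphi.
set E := prim e; have cE : continuous E := continuous_prim e_loc.
have l1 : locint (fun t => dphi t * E t).
  by apply: locintM => //; exact: continuous_locint.
have l2 : locint (fun t => phi t * e t) by exact: locintM.
have ldphi := continuous_locint cdphi.
have len := locint_norm e_loc.
set P := prim _.
suff H : forall y, is_derive y 1 (fun y => P y - phi y * E y) 0.
  have := der_cst x 0 H; rewrite /P /E !prim0 mulr0 subrr => /eqP.
  by rewrite subr_eq0 => /eqP.
move=> {}x; apply: der0_near => eps eps0.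
pose K : R := `|dphi x| + 1.
have K0 : 0 < K by rewrite /K; have := normr_ge0 (dphi x); lra.
pose eta : R := eps / (2 * K).
have eta0 : 0 < eta by rewrite divr_gt0// mulr_gt0.
have /nbhs_ballP[d /= d0 Hd] : \forall y \near x,
  [/\ `|dphi y| <= K, `|E x - E y| <= eta / 2 &
      `|prim (fun t => `|e t|) x - prim (fun t => `|e t|) y| <= eta].
  have A := continuous_near_le x cdphi ltr01.
  have B : \forall y \near x, `|E x - E y| <= eta / 2
    by apply: continuous_near_le => //; rewrite divr_gt0.
  have C := continuous_near_le x (continuous_prim len) eta0.
  near=> y; split; [|by near: y..].
  have : `|dphi x - dphi y| <= 1 by near: y.
  rewrite /K; have := ler_normB (dphi x) (dphi x - dphi y).
  by rewrite opprB addrC subrK; lra.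
exists d => //= y yd.
have yd' : `|x - y| < d by [].
have ball_between t : Num.min x y <= t <= Num.max x y -> `|x - t| <= `|x - y|.
  rewrite ge_min le_max => /andP[/orP[]h1 /orP[]h2]; rewrite ler_norml;
  have := ler_norm (x - y); have := ler_norm (y - x);
    rewrite (distrC y x) => k1 k2; apply/andP; split; lra.
have HB t : Num.min x y <= t <= Num.max x y ->
  [/\ `|dphi t| <= K, `|E x - E t| <= eta / 2 &
      `|prim (fun t => `|e t|) x - prim (fun t => `|e t|) t| <= eta].
  by move=> /ball_between H; apply: Hd; apply: le_lt_trans H _.
have phi_lipschitz t : Num.min x y <= t <= Num.max x y ->
  `|phi t - phi x| <= K * `|x - y|.
  move=> Ht; rewrite -(prim_der _ _ Dphi cdphi).
  apply: (@le_trans _ _ `|prim (fun=> K) t - prim (fun=> K) x|).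
    apply: prim_bound => //; first by apply/continuous_locint/continuous_const.
    move=> s Hs; have [] // := HB s.
    move: Hs Ht; rewrite !ge_min !le_max.
    case: (leP x y) => xy; lra.
  by rewrite !prim_cst -mulrBr normrM gtr0_norm// ler_pM2l// distrC
    ball_between.
have k1 : locint (fun t => dphi t * E t + phi t * e t) by exact: locintD.
pose k t := (dphi t * E t + phi t * e t) - (phi x * e t + E y * dphi t).
have lk : locint k by apply: locintB => //; apply: locintD; exact: locintZ.
have -> : P y - phi y * E y - (P x - phi x * E x) = prim k y - prim k x.
  rewrite /k !primB//; try by apply: locintD; exact: locintZ.
  rewrite !(primD (f := fun t => phi x * e t))//; try exact: locintZ.
  rewrite !primZ// -/P -/E.
  have -> : prim dphi y = phi y - phi x + prim dphi x
    by rewrite -(prim_der x y Dphi cdphi) subrK.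
  ring.
pose g t := eta * K + (K * `|x - y|) * `|e t|.
have lg : locint g.
  by apply: locintD; [apply/continuous_locint/continuous_const|exact: locintZ].
apply: (@le_trans _ _ `|prim g y - prim g x|).
  apply: prim_bound => // t Ht.
  have [b1 b2 _] := HB _ Ht.
  have [_ b3 _] : [/\ `|dphi y| <= K,
    `|E x - E y| <= eta / 2 & `|prim (fun t => `|e t|) x - prim (fun t =>
    `|e t|) y| <= eta].
    by apply: HB; rewrite ge_min le_max !lexx !orbT.
  have b4 : `|E t - E y| <= eta.
    have -> : E t - E y = (E x - E y) - (E x - E t) by lra.
    by apply: le_trans (ler_normB _ _) _; lra.
  have -> : k t = (E t - E y) * dphi t + (phi t - phi x) * e t by rewrite /k;
    ring.
  apply: le_trans (ler_normD _ _) _; rewrite !normrM.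
  by apply: lerD; apply: ler_pM => //; exact: phi_lipschitz.
have -> : prim g y - prim g x = (eta * K) * (y - x) + (K * `|x - y|) *
    (prim (fun t => `|e t|) y - prim (fun t => `|e t|) x).
  rewrite /g !primD ?primZ ?prim_cst//;
    try by [exact: locintZ|apply/continuous_locint/continuous_const].
  lra.
apply: le_trans (ler_normD _ _) _.
have -> : `|eta * K * (y - x)| = eta * K * `|y - x|
  by rewrite normrM gtr0_norm// mulr_gt0.
have -> (z : R) : `|K * `|x - y| * z| = K * `|x - y| * `|z|.
  by rewrite normrM ger0_norm// mulr_ge0// ltW.
have [|_ _ b5] := HB y; first by rewrite ge_min le_max !lexx !orbT.
rewrite distrC in b5 *.
have epsE : eps = 2 * (eta * K) by rewrite /eta; field; lra.
rewrite epsE (distrC x y).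
have : K * `|y - x| * `|prim (fun t => `|e t|) y - prim (fun t =>
  `|e t|) x| <= K * `|y - x| * eta.
  by apply: ler_wpM2l => //; rewrite mulr_ge0// ltW.
lra.
Unshelve. all: by end_near. Qed.
End PrimCalculus.

(** * Translations and periodic functions *)

Section Shift.
Context {R : realType}.
Implicit Types (f g : R -> R) (a b x y s T : R).

Lemma shift_preimage_cc s a b :
  (fun x => x + s) @^-1` `[a + s, b + s]%classic = `[a, b]%classic.
Proof.
by apply/seteqP; split => x /=; rewrite !in_itv/= !lerD2r.
Qed.

Lemma measurable_shift s : measurable_fun setT ((fun x : R => x + s) : _ ->
  measurableTypeR R).
Proof. by apply: measurable_funD. Qed.

(** Lebesgue measure is characterised by its values on half-open intervals, and
    those only depend on the length. *)
Lemma lebesgue_measure_shift s (A : set R) : measurable A ->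
  pushforward leb ((fun x : R => x + s)%R : _ -> measurableTypeR R) A = leb A.
Proof.
move=> mA; apply/esym/lebesgue_measure_unique => //=.
  exact: measurable_shift.
move=> _ _ [[a b]] _ <-.
rewrite /pushforward.
have -> : (fun x => x + s) @^-1` [set` `]a, b]] = [set` `]a - s, b - s]].
  by apply/seteqP; split => x /=; rewrite !in_itv/= ltrBlDr lerBrDr.
rewrite !lebesgue_measure_itv/= !lte_fin ltrD2r.
by case: ifP => // _; rewrite -!EFinB; congr (_%:E); lra.
Qed.

Lemma ge0_integral_shift (g : R -> \bar R) s a b :
  measurable_fun `[a + s, b + s] g -> (forall x, 0 <= g x)%E ->
  (\int[leb]_(x in `[(a + s)%R, (b + s)%R]) g x = \int[leb]_(x in `[a,
    b]) g (x + s)%R)%E.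
Proof.
move=> mg g0.
transitivity (\int[pushforward leb ((fun x : R => x + s)%R : _ ->
  measurableTypeR R)]_(y in `[(a + s)%R, (b + s)%R]) g y)%E.
  apply: eq_measure_integral; first exact: measurable_shift.
  by move=> ? A mA _; rewrite /= lebesgue_measure_shift.
by rewrite ge0_integral_pushforward ?shift_preimage_cc//;
  exact: measurable_shift.
Qed.

Lemma integrable_shift f s a b :
  leb.-integrable `[a, b] (fun x => (f (x + s))%:E) ->
  leb.-integrable `[a + s, b + s] (EFin \o f).
Proof.
move=> /integrableP[mf fi].
have mf' : measurable_fun `[a + s, b + s] (EFin \o f).
  have -> : EFin \o f = (fun x => (f (x + s))%:E) \o (fun x => x + (- s)).
    by apply/funext => x /=; rewrite subrK.
  apply: (measurable_comp (F := `[a, b]%classic)) mf _ => //.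
    move=> _ [x /= + <-]; rewrite !in_itv/= => /andP[h1 h2].
    by apply/andP; split; lra.
  by apply: measurable_funTS; exact: measurable_shift.
apply/integrableP; split => //.
rewrite ge0_integral_shift//; exact: measurableT_comp.
Qed.

Lemma Rintegral_shift f s a b : locint f ->
  \int[leb]_(x in `[a + s, b + s]) f x = \int[leb]_(x in `[a, b]) f (x + s).
Proof.
move=> lf; congr fine.
transitivity (\int[pushforward leb ((fun x : R => x + s)%R : _ ->
  measurableTypeR R)]_(y in `[(a + s)%R, (b + s)%R]) (f y)%:E)%E.
  apply: eq_measure_integral; first exact: measurable_shift.
  by move=> ? A mA _; rewrite /= lebesgue_measure_shift.
have mfT : measurable_fun setT (fun x => (f x)%:E) by apply/measurable_EFinP;
  case: lf.
rewrite integral_pushforward ?shift_preimage_cc//;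
  first exact: measurable_shift.
apply/integrableP; split.
  by apply: measurable_funTS; apply: (measurableT_comp mfT);
    exact: measurable_shift.
have /integrableP[mf] := locint_integrable (a + s) (b + s) lf.
by rewrite (ge0_integral_shift (g := fun x => `|(f x)%:E|%E))//;
  exact: measurableT_comp.
Qed.

Lemma integrable_adjacent f a b c : a <= b -> b <= c ->
  leb.-integrable `[a, b] (EFin \o f) -> leb.-integrable `[b, c] (EFin \o f) ->
  leb.-integrable `[a, c] (EFin \o f).
Proof.
move=> ab bc /integrableP[m1 i1] /integrableP[m2 i2].
have E : `[a, c]%classic = `[a, b] `|` `[b, c].
  apply/seteqP; split => x /=; rewrite !in_itv/=.
    by move=> /andP[-> ->]; rewrite !andbT/=; apply/orP/le_total.
  case=> /andP[h1 h2]; apply/andP; split; lra.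
have mf : measurable_fun `[a, c] (EFin \o f).
  by rewrite E; apply/measurable_funU.
apply/integrableP; split => //.
have E' : `[a, c]%classic = `[a, b] `|` `]b, c].
  apply/seteqP; split => x /=; rewrite !in_itv/=.
    by move=> /andP[-> ->]; rewrite !andbT/=; case: (leP x b); [left|right].
  case=> /andP[h1 h2]; apply/andP; split; lra.
rewrite E' ge0_integral_setU//=.
- rewrite lte_add_pinfty//; apply: le_lt_trans i2.
  apply: ge0_subset_integral => //=.
    by apply/measurable_EFinP; apply: measurableT_comp => //;
      exact/measurable_EFinP.
  by apply: subset_itvr; rewrite bnd_simp.
- by rewrite -E'; apply/measurable_EFinP; apply: measurableT_comp => //;
    exact/measurable_EFinP.
- apply/disj_setPS => x /= []; rewrite !in_itv/= => /andP[_ h1] /andP[h2 _].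
  by move: (lt_le_trans h2 h1); rewrite ltxx.
Qed.

Lemma periodic_subn f T n x : periodic f T -> f (x - n%:R * T) = f x.
Proof.
move=> pf; elim: n => [|n <-]; first by rewrite mul0r subr0.
by rewrite -pf -natr1; congr f; ring.
Qed.

Lemma periodic_addn f T n x : periodic f T -> f (x + n%:R * T) = f x.
Proof.
by move=> pf; rewrite -(periodic_subn n (x + _) pf) addrK.
Qed.

(** Integrability spreads from [0, T] to [-n T, n T] by adding one translated
    period at each end; measurability on the line follows from the covering by
    these segments. *)
Lemma integrable_periodic f T : 0 < T -> periodic f T ->
  leb.-integrable `[0, T] (EFin \o f) -> locint f.
Proof.
move=> T0 pf f0T.
have H n : leb.-integrable `[- (n%:R * T), n%:R * T] (EFin \o f).
  elim: n => [|n IH].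
    by apply: integrableS f0T => // x /=; rewrite !in_itv/=; lra.
  have nT : 0 <= n%:R * T by rewrite mulr_ge0// ltW.
  have -> : n.+1%:R * T = n%:R * T + T by rewrite -natr1; ring.
  apply: (@integrable_adjacent _ _ (n%:R * T)); [lra|lra| |].
    apply: (@integrable_adjacent _ _ (- (n%:R * T))) => //; [lra|lra|].
    have := @integrable_shift f (- (n.+1%:R * T)) 0 T.
    rewrite -natr1 add0r; have -> : T - (n%:R + 1) * T = - (n%:R * T) by ring.
    have -> : - ((n%:R + 1) * T) = - (n%:R * T + T) by ring.
    apply; rewrite (_ : (fun x => _) = EFin \o f)//.
    apply/funext => x /=; congr EFin.
    by rewrite -[RHS](periodic_subn n.+1 _ pf) -natr1; congr f; ring.
  have := @integrable_shift f (n%:R * T) 0 T.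
  rewrite add0r (addrC T); apply; rewrite (_ : (fun x => _) = EFin \o f)//.
  by apply/funext => x /=; rewrite periodic_addn.
have H2 a b : leb.-integrable `[a, b] (EFin \o f).
  pose n := Num.bound ((`|a| + `|b|) / T).
  have nT : `|a| + `|b| < n%:R * T.
    rewrite -ltr_pdivrMr//; apply: archi_boundP.
    by rewrite divr_ge0// ?addr_ge0// ltW.
  apply: integrableS (H n) => // x /=; rewrite !in_itv/=.
  have := ler_norm b; have := ler_norm (- a); rewrite normrN;
    have := normr_ge0 a; have := normr_ge0 b; lra.
apply: integrable_locint => //.
have -> : [set: R] = \bigcup_n `[- n%:R, n%:R]%classic.
  apply/esym/seteqP; split => // x _; exists (Num.bound `|x|) => //=.
  by rewrite in_itv/= -ler_norml ltW// archi_boundP.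
apply/measurable_fun_bigcup => // n.
by apply/measurable_EFinP; have /integrableP[] := H2 (- n%:R) n%:R.
Qed.

(** By translation invariance, increments of [prim f] over [a, b] and over
    [a + T, b + T] agree, so [prim f (x + T) - prim f x] keeps its value at 0. *)
Lemma prim_periodic f T : 0 < T -> periodic f T -> locint f ->
  prim f T = 0 -> periodic (prim f) T.
Proof.
move=> T0 pf lf f0 x.
suff H a b : a <= b -> prim f (b + T) - prim f (a + T) = prim f b - prim f a.
  have := prim0 f; have [/H|/ltW/H] := leP 0 x; rewrite add0r; lra.
move=> ab; rewrite !prim_incr//; last by lra.
rewrite Rintegral_shift//; apply: eq_Rintegral => y _; exact: pf.
Qed.

End Shift.

(** * Square integrability *)

Section SquareIntegrable.
Context {R : realType}.
Implicit Types (f g e : R -> R) (a b x y s T : R).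

Lemma integrable_oo_cc f a b : leb.-integrable `]a, b[ (EFin \o f) ->
  leb.-integrable `[a, b] (EFin \o f).
Proof.
move=> /integrableP[mf fi]; apply/integrableP; split.
  exact: emeasurable_fun_itv_cc mf.
have ma : measurable_fun `]a, b[ (fun x => `|(EFin \o f) x|%E).
  by apply: measurableT_comp.
rewrite -integral_itv_obnd_cbnd; last exact/emeasurable_fun_itv_bndo_bndcP.
by rewrite -integral_itv_bndo_bndc.
Qed.

(** On a bounded interval |e| <= 1 + e^2, so square integrability gives
    integrability; periodicity then extends both to the line. *)
Lemma L2_on_locint T e : 0 < T -> periodic e T -> L2_on `]0, T[ e ->
  locint e /\ locint (fun x => e x ^+ 2).
Proof.
move=> T0 pe Le.
have i2 := Lfun2_integrable_sqr Le.
have me : measurable_fun `]0, T[ e.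
  apply/(measurable_restrictT _ _).2 => //.
  by move: Le; rewrite /L2_on inE => /andP[]; rewrite inE.
have j2 : leb.-integrable `]0, T[ (EFin \o (fun x => e x ^+ 2)).
  have i2' : leb.-integrable `]0, T[ (EFin \o (fun x => (e \_ `]0, T[) x ^+ 2)).
    by apply: integrableS i2.
  apply: eq_integrable i2' => // x xD /=.
  by rewrite patchE xD.
have j1 : leb.-integrable `]0, T[ (EFin \o e).
  have idom : leb.-integrable `]0, T[ (EFin \o (fun x => 1 + e x ^+ 2)).
    have c1 : leb.-integrable `]0, T[ (EFin \o (fun=> 1 : R)).
      apply: integrableS (locint_integrable 0 T (continuous_locint
        (@continuous_const R 1))) => //.
      exact: subset_itv_oo_cc.
    have := integrableD _ c1 j2; rewrite (_ : (_ \+ _)%E = EFin \o (fun x =>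
      1 + e x ^+ 2)); last first.
      by apply/funext => x /=; rewrite EFinD.
    exact.
  apply: le_integrable idom => //; first by apply/measurable_EFinP.
  move=> x _; rewrite /= lee_fin.
  rewrite [leRHS]ger0_norm ?addr_ge0 ?sqr_ge0//.
  rewrite -[e x ^+ 2]real_normK ?num_real//.
  have := sqr_ge0 (`|e x| - 1); have := sqr_ge0 (`|e x|); rewrite !expr2; nra.
split; apply: (integrable_periodic T0) => //; try exact: integrable_oo_cc.
by move=> x; rewrite pe.
Qed.

Lemma locint_sqr_L2_loc f : measurable_fun setT f ->
  locint (fun x => f x ^+ 2) ->
  L2_loc f.
Proof.
move=> mf f2 a b; rewrite /L2_on inE; apply/andP; split; rewrite inE/=.
  apply/(measurable_restrictT _ _).1 => //; exact: measurable_funTS.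
rewrite /finite_norm unlock /Lnorm poweR_lty//.
have /integrableP[_] := locint_integrable a b f2.
rewrite [X in (X < _)%E -> _]integral_mkcond => H; apply: le_lt_trans H.
rewrite le_eqVlt; apply/orP; left; apply/eqP; apply: eq_integral => x _.
rewrite /patch/=; case: ifP => _ /=.
  by rewrite powR_mulrn// normrX.
by rewrite [X in `|X|](_ : _ = 0 :> R)// normr0 powR0.
Qed.

Lemma locint_measurable f : locint f -> measurable_fun setT f.
Proof. by case. Qed.

Lemma locint_sqrD f g : locint f -> locint (fun x => f x ^+ 2) ->
  continuous g ->
  locint (fun x => (f x + g x) ^+ 2).
Proof.
move=> lf lf2 cg.
have -> : (fun x => (f x + g x) ^+ 2) = (fun x =>
  f x ^+ 2 + (2 * (g x * f x) + g x * g x)).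
  by apply/funext => x; ring.
apply: locintD => //; apply: locintD.
  by apply: locintZ; apply: locintM.
by apply: continuous_locint; apply: continuous_mul.
Qed.

End SquareIntegrable.

(** * Weak derivatives and the du Bois-Reymond lemma *)

Section WeakDerivative.
Context {R : realType}.
Implicit Types (f g e u v phi : R -> R) (a b x y s k h : R).

Lemma C1_compact_support_bound phi : C1_compact_support phi ->
  exists2 M : R, 0 < M & forall x, M <= `|x| -> phi x = 0.
Proof.
move=> [_ _ /compact_bounded[M [Mr HM]]].
exists (`|M| + 2); first by have := normr_ge0 M; lra.
move=> x xM; apply/eqP/negP => /negP phix.
have : `|x| <= `|M| + 1.
  apply: (HM (`|M| + 1)); first by have := ler_norm M; lra.
  by apply: subset_closure.
lra.
Qed.

Lemma C1_compact_support_der phi : C1_compact_support phi ->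
  forall x : R, is_derive x 1 phi (derive1 phi x).
Proof.
by move=> [dphi _ _] x; apply: DeriveDef => //; rewrite derive1E.
Qed.

Lemma derive1_outside phi M x : (forall x, M <= `|x| -> phi x = 0) ->
  M < `|x| -> derive1 phi x = 0.
Proof.
move=> HM Mx; rewrite derive1E.
rewrite (near_eq_derive (g := cst 0)); first by rewrite derive_cst.
near=> y; apply: HM; apply/ltW; near: y.
have := @lt_nbhsr R M `|x| Mx.
exact: (@norm_continuous _ R x).
Unshelve. all: by end_near. Qed.

Lemma Rintegral_supp f M : locint f -> 0 <= M -> (forall x, M < `|x| ->
  f x = 0) ->
  \int[leb]_x f x = prim f M - prim f (- M).
Proof.
move=> lf M0 fM; rewrite prim_incr//; last by lra.
rewrite [RHS]Rintegral_mkcond; apply: eq_Rintegral => x _.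
rewrite patchE; case: ifPn => //;
  rewrite notin_setE/= in_itv/= -ler_norml => /negP.
by rewrite -ltNge; exact: fM.
Qed.

Lemma locint_test f phi : locint f -> continuous phi ->
  locint (fun x => f x * phi x).
Proof.
move=> lf cphi; rewrite (_ : (fun x => _) = (fun x => phi x * f x)).
  exact: locintM.
by apply/funext => x; rewrite mulrC.
Qed.

Section test_function.
Variables (phi : R -> R) (phiP : C1_compact_support phi).

Lemma test_continuous : continuous phi.
Proof. exact: (der_continuous (C1_compact_support_der phiP)). Qed.

(** Integrals against a test function live on one common segment, whatever the
    other factor; this turns them into increments of primitives. *)
Lemma test_integrals : exists2 M : R, 0 < M &
  [/\ forall x, M <= `|x| -> phi x = 0,
  forall f, locint f -> \int[leb]_x (f x * phi x) =
    prim (fun x => f x * phi x) M - prim (fun x => f x * phi x) (- M) &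
  forall f, locint f -> \int[leb]_x (f x * derive1 phi x) =
    prim (fun x => f x * derive1 phi x) M - prim (fun x =>
      f x * derive1 phi x) (- M)].
Proof.
have [M M0 HM] := C1_compact_support_bound phiP.
exists M => //; split => //.
- move=> f lf; apply: Rintegral_supp; [|exact: ltW|].
    by apply: locint_test => //; exact: test_continuous.
  by move=> x /ltW/HM ->; rewrite mulr0.
- move=> f lf; apply: Rintegral_supp; [|exact: ltW|].
    by apply: locint_test => //; case: phiP.
  by move=> x /(derive1_outside HM) ->; rewrite mulr0.
Qed.

End test_function.

Lemma weak_derivativeD f f' g g' : weak_derivative f g ->
  weak_derivative f' g' ->
  weak_derivative (fun x => f x + f' x) (fun x => g x + g' x).
Proof.
move=> [lf lg H] [lf' lg' H']; split; [exact: locintD|exact: locintD|].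
move=> phi P; have [M M0 [HM I0 I1]] := test_integrals P.
have c0 := test_continuous P; have [_ c1 _] := P.
have := H' phi P; have := H phi P.
rewrite !I0//; try exact: locintD.
rewrite !I1//; try exact: locintD.
have e1 (a b c : R -> R) : (fun x => (a x + b x) * c x) = (fun x =>
  a x * c x + b x * c x).
  by apply/funext => x; rewrite mulrDl.
rewrite !e1 !primD//; try exact: locint_test.
lra.
Qed.

Lemma weak_derivativeZ f g k : weak_derivative f g ->
  weak_derivative (fun x => k * f x) (fun x => k * g x).
Proof.
move=> [lf lg H]; split; [exact: locintZ|exact: locintZ|].
move=> phi P; have [M M0 [HM I0 I1]] := test_integrals P.
have c0 := test_continuous P; have [_ c1 _] := P.
have := H phi P.
rewrite !I0//; try exact: locintZ.
rewrite !I1//; try exact: locintZ.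
have e1 (a b c : R -> R) : (fun x => (k * a x) * c x) = (fun x =>
  k * (a x * c x)).
  by apply/funext => x; rewrite mulrA.
rewrite !e1 // !primZ//; try exact: locint_test.
by rewrite -!mulrBr => ->; rewrite mulrN.
Qed.

Lemma weak_derivative_ae f g g' : locint g' -> weak_derivative f g ->
  {ae leb, forall x, g x = g' x} -> weak_derivative f g'.
Proof.
move=> lg' [lf lg H] gg'; split => // phi P.
rewrite (H phi P); congr (- _); congr fine.
apply: ae_eq_integral => //.
- by apply/measurable_EFinP; exact: (locint_measurable (locint_test lg
    (test_continuous P))).
- by apply/measurable_EFinP; exact: (locint_measurable (locint_test lg'
    (test_continuous P))).
- move: gg'; apply: filterS; first exact: (ae_filter_ringOfSetsType leb).
  by move=> x /= -> _.
Qed.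

(** Integration by parts on a segment that contains the support of the test
    function; the boundary terms vanish. *)
Lemma weak_derivative_prim f g : locint g -> (forall x, f x = f 0 + prim g x) ->
  weak_derivative f g.
Proof.
move=> lg fE.
have cf : continuous f.
  rewrite (_ : f = (fun x => f 0 + prim g x)); last by apply/funext.
  by apply: continuous_add; [exact: continuous_const|exact: continuous_prim].
have lf := continuous_locint cf.
split=> // phi P.
have [M M0 [HM I0 I1]] := test_integrals P.
have c0 := test_continuous P; have [_ c1 _] := P.
have Dphi := C1_compact_support_der P.
rewrite I0// I1//.
have := prim_by_parts M lg Dphi c1.
have := prim_by_parts (- M) lg Dphi c1.
rewrite !HM ?normrN ?gtr0_norm// !mul0r.
have l1 : locint (fun t => derive1 phi t * prim g t).
  by apply: locintM => //; exact/continuous_locint/continuous_prim.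
have l2 : locint (fun t => phi t * g t) by exact: locintM.
have l3 := continuous_locint c1.
rewrite !primD//.
rewrite (_ : (fun x => f x * derive1 phi x) = (fun x =>
  f 0 * derive1 phi x + derive1 phi x * prim g x)); last first.
  by apply/funext => x; rewrite [in LHS]fE; ring.
rewrite (_ : (fun x => g x * phi x) = (fun x => phi x * g x)); last first.
  by apply/funext => x; rewrite mulrC.
rewrite !primD//; try exact: locintZ.
rewrite !primZ//.
have := prim_der (- M) M Dphi c1.
rewrite !HM ?normrN ?gtr0_norm// => h.
have : f 0 * (prim (derive1 phi) M - prim (derive1 phi) (- M)) = 0
  by rewrite h subrr mulr0.
lra.
Qed.

Definition ramp h x : R := Num.min 1 (Num.max 0 (x / h + 1)).

Lemma ramp_bound h x : 0 <= ramp h x <= 1.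
Proof. by rewrite /ramp le_min ge_min le_max ler01 !lexx. Qed.

Lemma ramp1 h x : 0 < h -> 0 <= x -> ramp h x = 1.
Proof.
move=> h0 x0; rewrite /ramp; have : 0 <= x / h by rewrite divr_ge0// ltW.
by move=> ?; rewrite max_r ?min_l//; lra.
Qed.

Lemma ramp0 h x : 0 < h -> x <= - h -> ramp h x = 0.
Proof.
move=> h0 xh; rewrite /ramp; have : x / h <= -1 by rewrite ler_pdivrMr// mulN1r.
by move=> ?; rewrite max_l ?min_r//; lra.
Qed.

Lemma continuous_ramp h : continuous (ramp h).
Proof.
move=> x; apply: (@continuous_min R R (cst 1) (fun x => Num.max 0 (x / h + 1)));
  first exact: cvg_cst.
apply: (@continuous_max R R (cst 0) (fun x => x / h + 1)); first exact: cvg_cst.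
by apply: cvgD; [apply: cvgM => //; exact: cvg_cst|exact: cvg_cst].
Qed.

(** A trapezoid: 1 on [a, b], 0 outside [a - h, b + h]. *)
Definition trap a b h x : R := ramp h (x - a) * ramp h (b - x).

Lemma trap_bound a b h x : 0 <= trap a b h x <= 1.
Proof.
have /andP[h1 h2] := ramp_bound h (x - a);
  have /andP[h3 h4] := ramp_bound h (b - x).
by rewrite /trap mulr_ge0//= mulr_ile1.
Qed.

Lemma trap1 a b h x : 0 < h -> a <= x <= b -> trap a b h x = 1.
Proof. by move=> h0 /andP[ax xb]; rewrite /trap !ramp1 ?mulr1// subr_ge0. Qed.

Lemma trap0 a b h x : 0 < h -> (x <= a - h) || (b + h <= x) -> trap a b h x = 0.
Proof.
move=> h0 /orP[xh|xh]; rewrite /trap.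
  by rewrite [X in X * _]ramp0 ?mul0r//; lra.
by rewrite [X in _ * X]ramp0 ?mulr0//; lra.
Qed.

Lemma continuous_trap a b h : continuous (trap a b h).
Proof.
apply: continuous_mul; apply: (continuous_compose (g := ramp h));
  try exact: continuous_ramp.
  by move=> x; apply: cvgB => //; exact: cvg_cst.
by move=> x; apply: cvgB => //; exact: cvg_cst.
Qed.

Lemma prim_eq f g a b : locint f -> locint g -> a <= b ->
  (forall x, a <= x <= b -> f x = g x) ->
  prim f b - prim f a = prim g b - prim g a.
Proof.
by move=> lf lg ab fg; apply/eqP; rewrite eq_le !prim_le// => x /fg ->.
Qed.

(** A trapezoid differs from the indicator of [a, b] on two intervals of length
    h only. *)
Lemma trap_approx f a b h M : locint f -> 0 < h -> a <= b -> - M <= a - h ->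
  b + h <= M ->
  `|(prim (fun x => f x * trap a b h x) M - prim (fun x =>
    f x * trap a b h x) (- M))
     - (prim f b - prim f a)| <=
  (prim (fun x => `|f x|) (b + h) - prim (fun x => `|f x|) b) +
  (prim (fun x => `|f x|) a - prim (fun x => `|f x|) (a - h)).
Proof.
move=> lf h0 ab Ma bM.
set F := fun x => f x * trap a b h x.
have lF : locint F by apply: locint_test => //; exact: continuous_trap.
have l0 : locint (fun=> 0 : R) by apply/continuous_locint/continuous_const.
have ln := locint_norm lf.
have z1 : prim F (a - h) - prim F (- M) = 0.
  rewrite (prim_eq lF l0)// ?prim_cst ?mul0r ?subrr// => x /andP[_ xa].
  by rewrite /F trap0 ?mulr0// xa.
have z2 : prim F M - prim F (b + h) = 0.
  rewrite (prim_eq lF l0)// ?prim_cst ?mul0r ?subrr// => x /andP[xa _].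
  by rewrite /F trap0 ?mulr0// xa orbT.
have z3 : prim F b - prim F a = prim f b - prim f a.
  by apply: prim_eq => // x xab; rewrite /F trap1 ?mulr1.
have Fb c d : c <= d -> `|prim F d - prim F c| <= prim (fun x =>
  `|f x|) d - prim (fun x => `|f x|) c.
  move=> cd; apply: le_trans (prim_norm lF cd) _; apply: prim_le => //;
    first exact: locint_norm.
  move=> x _; have /andP[t0 t1] := trap_bound a b h x.
  by rewrite /F normrM ler_piMr// ger0_norm.
have b1 : b <= b + h by rewrite lerDl ltW.
have b2 : a - h <= a by rewrite gerBl ltW.
rewrite (_ : _ - _ - _ = (prim F (b + h) - prim F b) + (prim F a - prim F
  (a - h))); last first.
  move: z1 z2 z3; set p1 := prim F M; set p2 := prim F (- M);
    set p3 := prim F (a - h).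
  by set p4 := prim F (b + h); set p5 := prim F b; set p6 := prim F a;
    set p7 := prim f b; set p8 := prim f a; lra.
by apply: le_trans (ler_normD _ _) _; apply: lerD; exact: Fb.
Qed.

Lemma trap_cvg f a b M : locint f -> a <= b -> - M < a -> b < M ->
  (prim (fun x => f x * trap a b h x) M - prim (fun x =>
    f x * trap a b h x) (- M))
    @[h --> 0^'+] --> prim f b - prim f a.
Proof.
move=> lf ab Ma bM; apply/cvgrPdist_le => /= eps eps0.
have cn := continuous_prim (locint_norm lf).
have e20 : 0 < eps / 2 by rewrite divr_gt0.
have /nbhs_ballP[d1 /= d10 A] := continuous_near_le a cn e20.
have /nbhs_ballP[d2 /= d20 B] := continuous_near_le b cn e20.
near=> h.
have h0 : 0 < h by near: h; exact: nbhs_right_gt.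
have h1 : h < a + M by near: h; apply: nbhs_right_lt; lra.
have h2 : h < M - b by near: h; apply: nbhs_right_lt; lra.
have h3 : h < d1 by near: h; exact: nbhs_right_lt.
have h4 : h < d2 by near: h; exact: nbhs_right_lt.
rewrite distrC; apply: le_trans (trap_approx lf h0 ab _ _) _; [lra|lra|].
have : `|prim (fun x => `|f x|) a - prim (fun x => `|f x|) (a - h)| <= eps / 2.
  by apply: A; rewrite /ball/= subKr gtr0_norm.
have : `|prim (fun x => `|f x|) b - prim (fun x => `|f x|) (b + h)| <= eps / 2.
  by apply: B; rewrite /ball/= opprD addrA subrr sub0r normrN gtr0_norm.
rewrite distrC; have := ler_norm (prim (fun x => `|f x|) a - prim (fun x =>
  `|f x|) (a - h)).
have := ler_norm (prim (fun x => `|f x|) (b + h) - prim (fun x => `|f x|) b).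
lra.
Unshelve. all: by end_near. Qed.

(** A continuous function of mean zero with compact support is the derivative of
    a test function. Apply this to the combination of two trapezoids, over [a, b]
    and over [0, 1], whose masses cancel, and let their slopes become vertical:
    f has the same mean over [a, b] as over [0, 1]. *)
Lemma du_bois_reymond f : locint f ->
  (forall phi, C1_compact_support phi ->
    \int[leb]_x (f x * derive1 phi x) = 0) ->
  exists k, forall x, prim f x = k * x.
Proof.
move=> lf H; exists (prim f 1).
suff W a b : a <= b -> prim f b - prim f a = prim f 1 * (b - a).
  move=> x; have := prim0 f; have [/W|/ltW/W] := leP 0 x; lra.
move=> ab.
pose M : R := `|a| + `|b| + 2.
have [Ma bM M0 M1] : [/\ - M < a, b < M, - M < 0 & 1 < M].
  have := ler_norm (- a); have := ler_norm b; have := normr_ge0 a;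
    have := normr_ge0 b.
  by rewrite normrN /M => *; split; lra.
have l1 : locint (fun=> 1 : R) by apply/continuous_locint/continuous_const.
pose J (c : R -> R) a b (h : R) :=
  prim (fun x => c x * trap a b h x) M - prim (fun x =>
  c x * trap a b h x) (- M).
have C1 := trap_cvg lf ab Ma bM.
have C2 := trap_cvg l1 ab Ma bM.
have C3 := trap_cvg lf ler01 M0 M1.
have C4 := trap_cvg l1 ler01 M0 M1.
rewrite -/(J f a b) in C1; rewrite -/(J (fun=> 1) a b) in C2.
rewrite -/(J f 0 1) in C3; rewrite -/(J (fun=> 1) 0 1) in C4.
have EQ : \forall h \near 0^'+,
  J (fun=> 1) 0 1 h * J f a b h = J (fun=> 1) a b h * J f 0 1 h.
  near=> h.
  have h0 : 0 < h by near: h; exact: nbhs_right_gt.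
  have h1 : h < 1 by near: h; exact: nbhs_right_lt.
  (* Weighting each trapezoid by the mass of the other makes psi of mean zero. *)
  pose m1 := J (fun=> 1) 0 1 h; pose m2 := J (fun=> 1) a b h.
  pose psi x := m1 * trap a b h x - m2 * trap 0 1 h x.
  have cpsi : continuous psi.
    by apply: continuous_sub; apply: continuous_scale; exact: continuous_trap.
  have lpsi := continuous_locint cpsi.
  have psi0 x : M <= `|x| -> psi x = 0.
    have := ler_norm (- a); have := ler_norm b; have := normr_ge0 a;
      have := normr_ge0 b.
    rewrite normrN => h5 h6 h7 h8 h9.
    have : (x <= - M) || (M <= x).
      move: h9; rewrite ler_normr => /orP[->|]; first by rewrite orbT.
      by rewrite lerNr => ->.
    move=> /orP[] xM; rewrite /psi !trap0 ?mulr0 ?subrr//; apply/orP;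
      rewrite /M in xM *; [left|left|right|right]; lra.
  pose phi x := prim psi x - prim psi (- M).
  have Dphi (x : R) : is_derive x 1 phi (psi x).
    apply: der_eq (derB (is_derive_prim lpsi (cpsi x)) (derC _ x)) _.
    by rewrite subr0.
  have phi'E : derive1 phi = psi.
    by apply/funext => x; rewrite derive1E; apply: derive_val.
  have l0 : locint (fun=> 0 : R) by apply/continuous_locint/continuous_const.
  have Mpos : 0 < M by lra.
  have ltr c d : locint (trap c d h) by exact/continuous_locint/continuous_trap.
  have tE c d : (fun x => (fun=> 1) x * trap c d h x) = trap c d h.
    by apply/funext => x; rewrite mul1r.
  have m1E : prim (trap 0 1 h) M - prim (trap 0 1 h) (- M) = m1.
    by rewrite /m1 /J tE.
  have m2E : prim (trap a b h) M - prim (trap a b h) (- M) = m2.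
    by rewrite /m2 /J tE.
  have psiM : prim psi M - prim psi (- M) = 0.
    rewrite /psi !primB//; try exact: locintZ.
    rewrite !primZ//; move: m1E m2E.
    set p1 := prim _ M; set p2 := prim _ (- M); set p3 := prim _ M;
      set p4 := prim _ (- M) => q1 q2.
    by rewrite -q1 -q2; ring.
  have phi0 x : M <= `|x| -> phi x = 0.
    rewrite ler_normr => /orP[xM|xM].
      have : prim psi x - prim psi M = 0.
        rewrite (prim_eq lpsi l0)// ?prim_cst ?mul0r ?subrr// => y /andP[My _].
        by apply: psi0; rewrite (le_trans My)// ler_norm.
      by rewrite /phi; lra.
    have xM' : x <= - M by rewrite lerNr.
    have : prim psi (- M) - prim psi x = 0.
      rewrite (prim_eq lpsi l0)// ?prim_cst ?mul0r ?subrr// => y /andP[_ My].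
      by apply: psi0; rewrite ler_normr lerNr My orbT.
    by rewrite /phi; lra.
  have phiP : C1_compact_support phi.
    split.
    - by move=> x; case: (Dphi x).
    - by rewrite phi'E.
    - apply: (subclosed_compact (B := `[- M, M]%classic)).
      + exact: closed_closure.
      + exact: segment_compact.
      + rewrite closureE; apply: smallest_sub; first exact: interval_closed.
        move=> x /= phix; rewrite in_itv/= -ler_norml leNgt; apply/negP => Mx.
        by move/eqP: phix; apply; apply: phi0; exact: ltW.
  have := H phi phiP; rewrite phi'E (@Rintegral_supp _ M) ?(ltW Mpos)//.
  - have lt1 c d : locint (fun x => f x * trap c d h x).
      by apply: locint_test => //; exact: continuous_trap.
    rewrite (_ : (fun x => f x * psi x) = (fun x =>
      m1 * (f x * trap a b h x) - m2 * (f x * trap 0 1 h x))); last first.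
      by apply/funext => x; rewrite /psi; ring.
    rewrite !primB//; try exact: locintZ.
    rewrite !primZ//.
    rewrite -/m1 -/m2 /J => q.
    by apply/eqP; rewrite -subr_eq0; apply/eqP; rewrite -[RHS]q; ring.
  - exact: locint_test.
  - by move=> x /ltW/psi0 ->; rewrite mulr0.
rewrite !prim_cst in C2 C4; rewrite prim0 in C3.
have L1 : J (fun=> 1) 0 1 h * J f a b h @[h --> 0^'+] --> (1 * 1 - 1 * 0) *
  (prim f b - prim f a).
  by apply: cvgM.
have L2 : J (fun=> 1) a b h * J f 0 1 h @[h --> 0^'+] --> (1 * b - 1 * a) *
  (prim f 1 - 0).
  by apply: cvgM.
have L3 : J (fun=> 1) 0 1 h * J f a b h @[h --> 0^'+] --> (1 * b - 1 * a) *
  (prim f 1 - 0).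
  apply: cvg_trans L2; apply: near_eq_cvg; apply: filterS EQ => h /= ->;
    reflexivity.
have EE : (1 * 1 - 1 * 0) * (prim f b - prim f a) = (1 * b - 1 * a) *
  (prim f 1 - 0).
  exact: (cvg_unique (@Rhausdorff R) L1 L3).
lra.
Unshelve. all: by end_near. Qed.

End WeakDerivative.

(** * Reduction to a first-order system *)

Section ClassicalForm.
Context {R : realType}.
Implicit Types (T p c m a b x y k : R) (f g e E u v w z : R -> R).

(** The first-order system satisfied by u and z = u' + c u - E. For E = [prim e]
    it is the problem of the theorem, see [positive_to_classical] and
    [classical_to_positive]. *)
Definition classical_solution T p c E m u :=
  [/\ forall t, 0 < u t, periodic u T & exists z : R -> R,
    (forall t : R, is_derive t 1 u (z t + E t - c * u t)) /\
    (forall t : R, is_derive t 1 z (m - (u t `^ p)^-1))].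

Lemma continuous_invpow p u : continuous u -> (forall t, 0 < u t) ->
  continuous (fun t => (u t `^ p)^-1).
Proof.
move=> cu u0 t; apply: cvgV; first by rewrite gt_eqF// powR_gt0.
apply: (@continuous_comp _ _ _ u (fun s => s `^ p)); first exact: cu.
apply: differentiable_continuous; apply/derivable1_diffP.
exact: (@ex_derive _ _ _ _ _ _ _ (is_derive1_powR p (u0 t))).
Qed.

Lemma weak_derivative0 f : weak_derivative f (fun=> 0) ->
  exists k, forall x, prim f x = k * x.
Proof.
move=> [lf _ H]; apply: du_bois_reymond => // phi P; rewrite H//.
rewrite (_ : (fun x => _) = (fun=> 0)) ?[\int[_]_x 0]Rintegral_cst ?mul0r
  ?oppr0//.
by apply/funext => x; rewrite mul0r.
Qed.

(** Both v - (prim h + E - c u), where h = m - u^-p, and u - prim v have weak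
    derivative 0. By the du Bois-Reymond lemma the first has the primitive of a
    constant, so that [prim v] is also the primitive of a continuous function;
    the second, being continuous, is a constant. Hence u is C^1. *)
Lemma positive_to_classical T p c e m u : locint e ->
  positive_solution T p c e m u -> classical_solution T p c (prim e) m u.
Proof.
move=> e_loc [u0 [v [w [[[uv vw Lu Lv Lw] cu pu] Hae]]]].
have [lu lv _] := uv; have [_ lw _] := vw.
pose h t := m - (u t `^ p)^-1.
have ch : continuous h.
  by apply: continuous_sub; [exact: continuous_const|exact: continuous_invpow].
have lh := continuous_locint ch.
have wh : weak_derivative (prim h) h.
  by apply: weak_derivative_prim => // x; rewrite prim0 add0r.
have we : weak_derivative (prim e) e.
  by apply: weak_derivative_prim => // x; rewrite prim0 add0r.
have l0 : locint (fun=> 0 : R) by apply/continuous_locint/continuous_const.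
have W := weak_derivativeD (weak_derivativeD vw (weak_derivativeZ c uv))
  (weak_derivativeZ (-1) (weak_derivativeD wh we)).
have {}W := weak_derivative_ae l0 W _.
have {W}[|k Hk] := weak_derivative0 (W _).
  move: Hae; apply: filterS; first exact: (ae_filter_ringOfSetsType leb).
  by move=> x /= H; rewrite /h; lra.
(* vt is the continuous representative of v. *)
pose vt t := k + prim h t + prim e t - c * u t.
have cph := continuous_prim lh; have cpe := continuous_prim e_loc.
have cvt : continuous vt.
  apply: continuous_sub; last exact: continuous_scale.
  by apply: continuous_add => //; apply: continuous_add => //;
    exact: continuous_const.
have lvt := continuous_locint cvt.
have pv x : prim v x = prim vt x.
  apply/eqP; rewrite -subr_eq0 -primB//; apply/eqP.
  have lk : locint (fun=> k) by apply/continuous_locint/continuous_const.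
  rewrite -[RHS](subrr (k * x)) -[X in _ = X - _]Hk -prim_cst -primB//;
    last first.
    apply: locintD; first by apply: locintD => //; exact: locintZ.
    by apply: locintZ; apply: locintD; exact: continuous_locint.
  congr prim; apply/funext => t; rewrite /vt; ring.
have wpv : weak_derivative (prim v) v.
  by apply: weak_derivative_prim => // x; rewrite prim0 add0r.
have W := weak_derivativeD uv (weak_derivativeZ (-1) wpv).
have {}W := weak_derivative_ae l0 W _.
have {W}[|k' Hk'] := weak_derivative0 (W _).
  by apply: aeW => x /=; lra.
have cpv := continuous_prim lv.
have cD : continuous (fun x => u x + -1 * prim v x).
  by apply: continuous_add => //; exact: continuous_scale.
have uE x : u x = k' + prim vt x.
  have D1 := is_derive_prim (continuous_locint cD) (cD x).
  have D2 := derZ k' (derX x).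
  have -> : prim vt x = prim v x by rewrite pv.
  have E1 : prim (fun x => u x + -1 * prim v x) = (fun y => k' * y).
    by apply/funext => y; rewrite Hk'.
  rewrite E1 in D1.
  have := @derive_val _ _ _ _ _ _ _ D1; rewrite (@derive_val _ _ _ _ _ _ _ D2);
    lra.
split => //; exists (fun t => k + prim h t); split => t.
  have -> : u = (fun x => k' + prim vt x) by apply/funext.
  apply: der_eq (derD (derC k' t) (is_derive_prim lvt (cvt t))) _.
  by rewrite add0r /vt -uE.
apply: der_eq (derD (derC k t) (is_derive_prim lh (ch t))) _.
by rewrite add0r.
Qed.

(** The first derivative is continuous and the second is e plus a continuous
    function, so that both are locally square integrable and u and u' are their
    primitives. *)
Lemma classical_to_positive T p c e m u : locint e ->
  locint (fun x => e x ^+ 2) ->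
  classical_solution T p c (prim e) m u -> positive_solution T p c e m u.
Proof.
move=> e_loc e2_loc [u0 pu [z [Du Dz]]].
have cu := der_continuous Du; have cz := der_continuous Dz.
pose v t := z t + prim e t - c * u t.
pose h t := m - (u t `^ p)^-1.
have ch : continuous h.
  by apply: continuous_sub; [exact: continuous_const|exact: continuous_invpow].
have lh := continuous_locint ch.
have cv : continuous v.
  by apply: continuous_sub; [apply: continuous_add => //;
    exact: continuous_prim|exact: continuous_scale].
have lv := continuous_locint cv.
pose w t := e t + (h t - c * v t).
have chv : continuous (fun t => h t - c * v t) by apply: continuous_sub => //;
  exact: continuous_scale.
have lw : locint w by apply: locintD => //; exact: continuous_locint.
split => //; exists v, w; split; last first.
  by apply: aeW => t; rewrite /w /h; lra.
have cL2 f : continuous f -> L2_loc f.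
  move=> cf; apply: locint_sqr_L2_loc; first exact: continuous_measurable_fun.
  by apply: continuous_locint; apply: continuous_mul.
split => //; split; [| |exact: cL2|exact: cL2|].
- apply: weak_derivative_prim => // x.
  have := @prim_der _ _ _ 0 x Du cv; rewrite prim0 subr0 -/v => ->; lra.
- apply: weak_derivative_prim => // x.
  have e1 := @prim_der _ _ _ 0 x Dz ch.
  have e2 := @prim_der _ _ _ 0 x Du cv.
  rewrite prim0 in e1; rewrite prim0 in e2.
  rewrite /w primD//; last exact: continuous_locint.
  rewrite primB//; last exact: locintZ.
  rewrite (primZ c x lv) -[prim h x]subr0 e1 -[prim v x]subr0 e2 /v prim0; lra.
- apply: locint_sqr_L2_loc; first exact: locint_measurable.
  exact: locint_sqrD.
Qed.

End ClassicalForm.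

(** * Maximum principle *)

Section Comparison.
Context {R : realType}.
Implicit Types (T p c m a b x y k r : R) (f df g e E u v w z h d Z H : R -> R).

(** One representative s of t modulo T serves all T-periodic functions. *)
Lemma periodic_range T t : 0 < T -> exists2 s, 0 <= s <= T &
  forall f, periodic f T -> f t = f s.
Proof.
move=> T0.
pose N := Num.bound (`|t| / T).
have tN : 0 <= t + N%:R * T.
  have : `|t| < N%:R * T by rewrite -ltr_pdivrMr//; apply: archi_boundP;
    rewrite divr_ge0// ltW.
  have := ler_norm (- t); rewrite normrN; lra.
pose n := Num.trunc ((t + N%:R * T) / T).
have /andP[n1 n2] : n%:R <= (t + N%:R * T) / T < n.+1%:R by apply: truncn_itv;
  rewrite divr_ge0// ltW.
exists (t + N%:R * T - n%:R * T).
  rewrite ler_pdivlMr// in n1; rewrite ltr_pdivrMr// -natr1 mulrDl mul1r in n2.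
  by apply/andP; split; lra.
by move=> f pf; rewrite periodic_subn// periodic_addn.
Qed.

Lemma periodic_max T f : 0 < T -> periodic f T -> continuous f ->
  exists2 t0, 0 <= t0 <= T & forall t, f t <= f t0.
Proof.
move=> T0 pf cf.
have [|t0 + H] := @EVT_max R f 0 T (ltW T0).
  exact: continuous_subspaceT.
rewrite in_itv/= => t0T; exists t0 => // t.
have [s sT ->//] := periodic_range t T0.
by apply: H; rewrite in_itv/=.
Qed.

Lemma periodic_min T f : 0 < T -> periodic f T -> continuous f ->
  exists2 t0, 0 <= t0 <= T & forall t, f t0 <= f t.
Proof.
move=> T0 pf cf.
have [||t0 t0T H] := @periodic_max T (fun x => - f x) T0.
- by move=> x; rewrite pf.
- exact: continuous_opp.
- by exists t0 => // t; rewrite -lerN2 H.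
Qed.

Lemma der_at_max f df t0 : derives f df -> (forall t, f t <= f t0) -> df t0 = 0.
Proof.
move=> Df H.
have ab : t0 - 1 <= t0 + 1 by lra.
have D0 : is_derive t0 1 f 0.
  apply: (derive1_at_max ab) => [t _| |t _]; last exact: H.
    exact: ex_derive.
  by rewrite in_itv/=; apply/andP; split; lra.
exact: derive_unique (Df t0) D0.
Qed.

Lemma der_at_min f df t0 : derives f df -> (forall t, f t0 <= f t) -> df t0 = 0.
Proof.
move=> Df H.
have DN : derives (fun x => - f x) (fun x => - df x) by move=> x; exact: derN.
have : - df t0 = 0 by apply: (der_at_max DN) => t; rewrite lerN2.
by move/eqP; rewrite oppr_eq0 => /eqP.
Qed.

Lemma expR_der k x : is_derive x 1 (fun y => expR (k * y)) (k * expR (k * x)).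
Proof.
rewrite mulrC; apply: (@der_comp _ (fun y => k * y) expR x k).
  by apply: der_eq (derZ k (derX x)) _; rewrite mulr1.
Qed.

(** At a point t0 where d attains a positive maximum, d' vanishes. The function
    exp(c t) d' has derivative exp(c t) H, positive as long as d is; hence d' is
    positive just after t0, which contradicts maximality. *)
Lemma maximum_principle T c d Z H : 0 < T -> periodic d T ->
  derives d (fun t => Z t - c * d t) -> derives Z H ->
  (forall t, 0 < d t -> 0 < H t) -> forall t, d t <= 0.
Proof.
move=> T0 pd Dd DZ dH.
have cd := der_continuous Dd.
have [t0 _ Hmax] := periodic_max T0 pd cd.
suff : d t0 <= 0 by move=> d0 t; exact: le_trans (Hmax t) d0.
rewrite leNgt; apply/negP => d0.
have d't0 := der_at_max Dd Hmax.
have e20 : 0 < d t0 / 2 by rewrite divr_gt0.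
have /nbhs_ballP[eta /= eta0 Hd] := continuous_near_le t0 cd e20.
pose b := t0 + eta / 2.
have t0b : t0 < b by rewrite /b; lra.
have dpos t : t0 <= t <= b -> 0 < d t.
  move=> /andP[h1 h2]; have : `|d t0 - d t| <= d t0 / 2.
    by apply: Hd; rewrite /ball/= ler0_norm /b in h2 *; lra.
  have := ler_norm (d t0 - d t); lra.
(* q is exp(c t) times the derivative of d. *)
pose q t := expR (c * t) * (Z t - c * d t).
have Dq (t : R) : is_derive t 1 q (expR (c * t) * H t).
  apply: der_eq (derM (expR_der c t) (derB (DZ t) (derZ c (Dd t)))) _.
  by ring.
have qpos t : t0 < t <= b -> 0 < q t.
  move=> /andP[h1 h2]; have <- : q t0 = 0 by rewrite /q d't0 mulr0.
  apply: (der_lt Dq) => // x /andP[h3 h4].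
  by rewrite mulr_gt0 ?expR_gt0//; apply/dH/dpos; apply/andP; split; lra.
have : d t0 < d b.
  apply: (der_lt Dd) => // x /andP[h1 h2].
  have : 0 < q x by apply: qpos; rewrite h1 ltW.
  by rewrite /q pmulr_rgt0 ?expR_gt0.
by rewrite ltNge Hmax.
Qed.

(** Sub- and supersolutions: the forcing terms h are compared only where the
    functions are in the wrong order. The common E disappears from the difference. *)
Lemma comparison T c E u1 z1 h1 u2 z2 h2 : 0 < T ->
  periodic u1 T -> periodic u2 T ->
  derives u1 (fun t => z1 t + E t - c * u1 t) -> derives z1 h1 ->
  derives u2 (fun t => z2 t + E t - c * u2 t) -> derives z2 h2 ->
  (forall t, u1 t < u2 t -> h1 t < h2 t) -> forall t, u2 t <= u1 t.
Proof.
move=> T0 p1 p2 Du1 Dz1 Du2 Dz2 H t.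
rewrite -subr_le0.
apply: (@maximum_principle T c (fun t => u2 t - u1 t) (fun t =>
  z2 t - z1 t) (fun t => h2 t - h1 t)) => //.
- by move=> x; rewrite p1 p2.
- by move=> x; apply: der_eq (derB (Du2 x) (Du1 x)) _; ring.
- by move=> x; rewrite !subr_gt0; exact: H.
Qed.

End Comparison.

(** * Uniqueness, monotonicity and continuous dependence *)

Section Solutions.
Context {R : realType} (T p c : R) (E : R -> R).
Hypotheses (T0 : 0 < T) (p0 : 0 < p) (pE : periodic E T).
Implicit Types (m a b x y k r t : R) (f df g u v w z h d Z H : R -> R).
Local Notation sol := (classical_solution T p c E).

Lemma invpow_lt a b : 0 < a -> a < b -> (b `^ p)^-1 < (a `^ p)^-1.
Proof.
move=> a0 ab; have b0 := lt_trans a0 ab.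
by rewrite ltf_pV2 ?posrE ?powR_gt0// gt0_ltr_powR// nnegrE ltW.
Qed.

Lemma invpow_le a b : 0 < a -> a <= b -> (b `^ p)^-1 <= (a `^ p)^-1.
Proof.
by move=> a0; rewrite le_eqVlt => /predU1P[->//|/(invpow_lt a0)/ltW].
Qed.

(** Where u1 < u2, one has m1 - u1^-p < m2 - u2^-p, as [comparison] requires. *)
Lemma solution_antitone m1 m2 u1 u2 : sol m1 u1 -> sol m2 u2 -> m1 <= m2 ->
  forall t, u2 t <= u1 t.
Proof.
move=> [pos1 per1 [z1 [Du1 Dz1]]] [pos2 per2 [z2 [Du2 Dz2]]] m12.
apply: (comparison T0 per1 per2 Du1 Dz1 Du2 Dz2) => t u12.
by have := invpow_lt (pos1 t) u12; lra.
Qed.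

Lemma solution_unique m u1 u2 : sol m u1 -> sol m u2 -> u1 = u2.
Proof.
move=> s1 s2; apply/funext => t; apply/eqP; rewrite eq_le.
by rewrite (solution_antitone s1 s2)// (solution_antitone s2 s1).
Qed.

Lemma der_periodic f df : derives f df -> periodic f T -> periodic df T.
Proof.
move=> Df pf t.
have D1 : is_derive t 1 (fun x => f (x + T)) (df (t + T)).
  apply: der_eq (@der_comp _ (fun x =>
    x + T) f t _ _ (derD (derX t) (derC T t)) (Df (t + T))) _.
  by rewrite addr0 mulr1.
rewrite (_ : (fun x => _) = f) in D1; last by apply/funext => x; rewrite pf.
exact: derive_unique D1 (Df t).
Qed.

Lemma momentum_periodic u z : periodic u T ->
  derives u (fun t => z t + E t - c * u t) ->
  periodic z T.
Proof.
by move=> pu Du t; have := der_periodic Du pu t; rewrite pu pE; lra.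
Qed.

(** The periodic function z has equal values at 0 and T, so h = z' vanishes
    somewhere in between. *)
Lemma momentum_mean u z h : periodic u T ->
  derives u (fun t => z t + E t - c * u t) ->
  derives z h -> (exists2 t, 0 <= t <= T & 0 <= h t) /\ (exists2 t,
    0 <= t <= T & h t <= 0).
Proof.
move=> pu Du Dz; have pz := momentum_periodic pu Du.
have E0 : z T = z 0 by rewrite -(pz 0) add0r.
have [t /andP[/ltW t0 /ltW tT] Et] := der_mvt (fun x _ => Dz x) T0.
have : h t = 0.
  by move/eqP: Et; rewrite E0 subrr subr0 eq_sym mulf_eq0 (gt_eqF T0) orbF =>
    /eqP.
by move=> ht; split; exists t; rewrite ?t0 ?tT ?ht.
Qed.

Lemma solution_mu_gt0 m u : sol m u -> 0 < m.
Proof.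
move=> [pos per [z [Du Dz]]]; have [[t _ ht] _] := momentum_mean per Du Dz.
have : 0 < (u t `^ p)^-1 by rewrite invr_gt0 powR_gt0.
lra.
Qed.

(** The primitive is both nondecreasing and periodic, hence constant. *)
Lemma periodic_ge0_prim0 f : continuous f -> periodic f T ->
  (forall t, 0 <= f t) ->
  prim f T = 0 -> forall t, f t = 0.
Proof.
move=> cf pf f0 fT t.
have lf := continuous_locint cf.
have pp := prim_periodic T0 pf lf fT.
have l0 : locint (fun=> 0 : R) by apply/continuous_locint/continuous_const.
have mon a b : a <= b -> prim f a <= prim f b.
  move=> ab; have := prim_le l0 lf ab (fun x _ => f0 x).
  by rewrite !prim_cst; lra.
have P0 : prim f = fun=> 0.
  apply/funext => x; have [s /andP[s0 sT] ->//] := periodic_range x T0.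
  have := mon _ _ s0; have := mon _ _ sT; rewrite fT prim0 => h1 h2.
  by apply/eqP; rewrite eq_le h1.
have := is_derive_prim lf (cf t); rewrite P0 => D.
exact: derive_unique D (derC 0 t).
Qed.

Lemma solution_continuous m u : sol m u -> continuous u.
Proof. by move=> [_ _ [z [Du _]]]; exact: der_continuous Du. Qed.

(** The two solutions are ordered, so equal means make them equal; then m is
    determined by the equation. *)
Lemma solution_prim_inj m1 m2 u1 u2 : sol m1 u1 -> sol m2 u2 ->
  prim u1 T = prim u2 T -> u1 = u2 /\ m1 = m2.
Proof.
wlog m12 : m1 m2 u1 u2 / m1 <= m2.
  move=> W s1 s2 e12; have [m12|m21] := orP (le_total m1 m2); first exact: W.
  by have [-> ->] := W _ _ _ _ m21 s2 s1 (esym e12).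
move=> s1 s2 e12.
have c1 := solution_continuous s1; have c2 := solution_continuous s2.
have le21 := solution_antitone s1 s2 m12.
have u12 : u1 = u2.
  apply/funext => t; apply/eqP; rewrite -subr_eq0; apply/eqP.
  apply: (@periodic_ge0_prim0 (fun t => u1 t - u2 t)).
  - exact: continuous_sub.
  - by move: s1 s2 => [_ q1 _] [_ q2 _] x; rewrite q1 q2.
  - by move=> x; rewrite subr_ge0.
  - by rewrite primB ?e12 ?subrr//; exact: continuous_locint.
split => //; move: s1 s2 => [_ _ [z1 [Du1 Dz1]]] [_ _ [z2 [Du2 Dz2]]].
rewrite u12 in Du1 Dz1.
have zz : z1 = z2.
  by apply/funext => t; have := derive_unique (Du1 t) (Du2 t); lra.
rewrite zz in Dz1; have := derive_unique (Dz1 0) (Dz2 0); lra.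
Qed.

Lemma periodic_gt0_lb f : continuous f -> periodic f T -> (forall t, 0 < f t) ->
  exists2 eta, 0 < eta & forall t, eta <= f t.
Proof.
by move=> cf pf f0; have [t0 _ H] := periodic_min T0 pf cf; exists (f t0).
Qed.

(** For small k > 0 the functions u + k and u - k are a super- and a subsolution
    of the problem for every m' close to m, because u^-p - (u + k)^-p and
    (u - k)^-p - u^-p are bounded below by a positive constant. *)
Lemma solution_near m u k : sol m u -> 0 < k ->
  exists2 eta, 0 < eta & forall m' u', sol m' u' -> `|m' - m| < eta ->
    forall t, `|u' t - u t| <= k.
Proof.
move=> s k0; have cu := solution_continuous s.
move: (s) => [pos per [z [Du Dz]]].
have [b b0 bu] := periodic_gt0_lb cu per pos.
(* The bound by b / 2 keeps the subsolution u - k1 positive. *)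
pose k1 := Num.min k (b / 2).
have k1k : k1 <= k by rewrite ge_min lexx.
have k1b : k1 <= b / 2 by rewrite ge_min lexx orbT.
have k10 : 0 < k1 by rewrite lt_min k0 divr_gt0.
pose up t := u t + k1; pose um t := u t - k1.
have cup : continuous up by apply: continuous_add => //;
  exact: continuous_const.
have cum : continuous um by apply: continuous_sub => //;
  exact: continuous_const.
have posp t : 0 < up t by rewrite addr_gt0.
have posm t : 0 < um t by rewrite /um; have := bu t; lra.
have [|||e1 e10 H1] := @periodic_gt0_lb (fun t =>
  (u t `^ p)^-1 - (up t `^ p)^-1).
- by apply: continuous_sub; exact: continuous_invpow.
- by move=> t; rewrite /up per.
- by move=> t; rewrite subr_gt0 invpow_lt// /up ltrDl.
have [|||e2 e20 H2] := @periodic_gt0_lb (fun t =>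
  (um t `^ p)^-1 - (u t `^ p)^-1).
- by apply: continuous_sub; exact: continuous_invpow.
- by move=> t; rewrite /um per.
- by move=> t; rewrite subr_gt0 invpow_lt// /um gtrBl.
have Dup : derives up (fun t => (z t + c * k1) + E t - c * up t).
  by move=> t; apply: der_eq (derD (Du t) (derC k1 t)) _; rewrite /up; ring.
have Dum : derives um (fun t => (z t - c * k1) + E t - c * um t).
  by move=> t; apply: der_eq (derB (Du t) (derC k1 t)) _; rewrite /um; ring.
have Dzp : derives (fun t => z t + c * k1) (fun t => m - (u t `^ p)^-1).
  by move=> t; apply: der_eq (derD (Dz t) (derC (c * k1) t)) _; rewrite addr0.
have Dzm : derives (fun t => z t - c * k1) (fun t => m - (u t `^ p)^-1).
  by move=> t; apply: der_eq (derB (Dz t) (derC (c * k1) t)) _; rewrite subr0.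
exists (Num.min e1 e2); first by rewrite lt_min e10.
move=> m' u' [pos' per' [z' [Du' Dz']]];
  rewrite lt_min ltr_norml => /andP[/andP[m1 m2] m3].
have {m3} [m3 m4] : m' - m < e2 /\ - e2 < m' - m by move: m3;
  rewrite ltr_norml => /andP[].
have A : forall t, u' t <= up t.
  apply: (comparison T0 _ per' Dup Dzp Du' Dz'); first by move=> t;
    rewrite /up per.
  by move=> t ut; have := invpow_lt (posp t) ut; have := H1 t; lra.
have B : forall t, um t <= u' t.
  apply: (comparison T0 per' _ Du' Dz' Dum Dzm); first by move=> t;
    rewrite /um per.
  by move=> t ut; have := invpow_lt (pos' t) ut; have := H2 t; lra.
move=> t; rewrite ler_norml; have := A t; have := B t; rewrite /up /um => h1 h2.
by apply/andP; split; lra.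
Qed.

End Solutions.

(** * Existence for Lipschitz nonlinearities *)

Section PeriodicLinear.
Context {R : realType} (T : R).
Hypothesis T0 : 0 < T.
Implicit Types (m a b x y k r t : R) (f df g u v w z h : R -> R).

(** The T-periodic solution of y' = r y + f, by variation of constants; the first
    summand is the initial value forced by y(T) = y(0). *)
Definition resolvent r f t : R :=
  expR (r * t) * (expR (r * T) / (1 - expR (r * T)) * prim (fun s =>
    expR (- r * s) * f s) T
                  + prim (fun s => expR (- r * s) * f s) t).

Lemma continuous_expR_scale k : continuous (fun s : R => expR (k * s)).
Proof. exact: (der_continuous (expR_der k)). Qed.

Lemma resolvent_der r f : continuous f ->
  derives (resolvent r f) (fun t => r * resolvent r f t + f t).
Proof.
move=> cf t.
have ch : continuous (fun s => expR (- r * s) * f s).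
  by apply: continuous_mul => //; exact: continuous_expR_scale.
have D := derM (expR_der r t) (derD (derC (expR (r * T) / (1 - expR
  (r * T)) * prim (fun s => expR (- r * s) * f s) T) t)
   (is_derive_prim (continuous_locint ch) (ch t))).
apply: der_eq D _; rewrite /resolvent add0r !mulrA -expRD mulNr subrr expR0;
  ring.
Qed.

(** The difference y(t + T) - y(t) solves w' = r w and vanishes at 0. *)
Lemma resolvent_periodic r f : r != 0 -> continuous f -> periodic f T ->
  periodic (resolvent r f) T.
Proof.
move=> r0 cf pf t.
have D := resolvent_der r cf.
have D1 (x : R) : is_derive x 1 (fun x =>
  resolvent r f (x + T) - resolvent r f x)
    (r * (resolvent r f (x + T) - resolvent r f x)).
  have Ds : is_derive x 1 (fun x =>
    resolvent r f (x + T)) (r * resolvent r f (x + T) + f (x + T)).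
    apply: der_eq (@der_comp _ (fun x =>
      x + T) (resolvent r f) x _ _ (derD (derX x) (derC T x)) (D (x + T))) _.
    by rewrite addr0 mulr1.
  by apply: der_eq (derB Ds (D x)) _; rewrite pf; ring.
have D2 (x : R) : is_derive x 1 (fun x =>
  expR (- r * x) * (resolvent r f (x + T) - resolvent r f x)) 0.
  by apply: der_eq (derM (expR_der (- r) x) (D1 x)) _; ring.
have := der_cst t 0 D2.
have q1 : 1 - expR (r * T) != 0.
  by rewrite subr_eq0 eq_sym -[X in _ != X]expR0 (inj_eq
    (@expR_inj R)) mulf_neq0// gt_eqF.
have -> : resolvent r f (0 + T) - resolvent r f 0 = 0.
  by rewrite add0r /resolvent prim0 !mulr0 expR0; field.
rewrite mulr0 => /eqP; rewrite mulf_eq0 gt_eqF ?expR_gt0//= subr_eq0.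
by move/eqP.
Qed.

(** At a maximum and at a minimum of w the derivative vanishes, so r w = - f
    there. *)
Lemma periodic_linear_bound r w f k : r != 0 -> periodic w T ->
  derives w (fun t => r * w t + f t) -> (forall t, `|f t| <= k) ->
  forall t, `|r| * `|w t| <= k.
Proof.
move=> r0 pw Dw fk t.
have cw := der_continuous Dw.
have [t1 _ H1] := periodic_max T0 pw cw.
have [t2 _ H2] := periodic_min T0 pw cw.
have e1 := der_at_max Dw H1; have e2 := der_at_min Dw H2.
rewrite -normrM.
(* w lies between its values at the two extremal points. *)
have b1 : `|r * w t1| <= k by rewrite -normrN (_ : - (r * w t1) = f t1)//; lra.
have b2 : `|r * w t2| <= k by rewrite -normrN (_ : - (r * w t2) = f t2)//; lra.
move: b1 b2; rewrite !ler_norml => /andP[b1 b2] /andP[b3 b4].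
have w1 := H1 t; have w2 := H2 t.
by case: (leP 0 r) => [r1|/ltW r1]; apply/andP; split; nra.
Qed.

Lemma resolvent_bound r f1 f2 k : r != 0 -> continuous f1 -> continuous f2 ->
  periodic f1 T -> periodic f2 T -> (forall t, `|f1 t - f2 t| <= k) ->
  forall t, `|resolvent r f1 t - resolvent r f2 t| <= k / `|r|.
Proof.
move=> r0 c1 c2 p1 p2 fk t.
rewrite ler_pdivlMr ?normr_gt0// mulrC.
have pw : periodic (fun t => resolvent r f1 t - resolvent r f2 t) T.
  by move=> x; rewrite !resolvent_periodic.
apply: (periodic_linear_bound r0 pw _ fk) => x.
by apply: der_eq (derB (resolvent_der r c1 x) (resolvent_der r c2 x)) _; ring.
Qed.

End PeriodicLinear.

Section Contraction.
Context {R : realType}.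
Implicit Types (f u v : R -> R).
(** Banach's fixed point theorem for the sup norm on continuous periodic
    functions. The iterates from 0 converge uniformly, at geometric speed. *)
Lemma periodic_contraction (T k C : R) (F : (R -> R) -> R -> R) : 0 <= k < 1 ->
  (forall u, continuous u -> periodic u T ->
    continuous (F u) /\ periodic (F u) T) ->
  (forall u v (M : R), continuous u -> periodic u T -> continuous v ->
    periodic v T ->
     (forall t, `|u t - v t| <= M) -> forall t, `|F u t - F v t| <= k * M) ->
  (forall t, `|F (fun=> 0) t| <= C) ->
  exists u, [/\ continuous u, periodic u T & F u = u].
Proof.
move=> /andP[k0 k1] DF FF C0.
pose u n := iter n F (fun=> 0).
have Du n : continuous (u n) /\ periodic (u n) T.
  elim: n => [|n [IH1 IH2]]; last exact: DF.
  by split => //; exact: continuous_const.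
have FFu n v (M : R) : continuous v -> periodic v T ->
  (forall t, `|u n t - v t| <= M) ->
    forall t, `|F (u n) t - F v t| <= k * M.
  by move=> cv pv; apply: FF => //; case: (Du n).
have C0' : 0 <= C by apply: le_trans (C0 0).
have step n t : `|u n.+1 t - u n t| <= k ^+ n * C.
  elim: n t => [|n IH] t; first by rewrite expr0 mul1r /= subr0 C0.
  by rewrite exprS -mulrA; have [cn pn] := Du n; exact: (FFu n.+1).
pose q := C / (1 - k).
have q0 : 0 <= q by rewrite divr_ge0// subr_ge0 ltW.
have Cq : C = q * (1 - k) by rewrite /q; field; lra.
have dist n j t : `|u (n + j)%N t - u n t| <= k ^+ n * q * (1 - k ^+ j).
  elim: j => [|j IH]; first by rewrite addn0 subrr normr0 expr0 subrr mulr0.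
  rewrite addnS (_ : _ - _ = (u (n + j).+1 t - u (n + j)%N t) + (u
    (n + j)%N t - u n t)); last by ring.
  apply: le_trans (ler_normD _ _) _; apply: le_trans (lerD (step _ _) IH) _.
  by rewrite exprD exprS Cq le_eqVlt; apply/orP; left; apply/eqP; ring.
have kq n : 0 <= k ^+ n * q by apply: mulr_ge0 => //; exact: exprn_ge0.
have dist' n j t : `|u (n + j)%N t - u n t| <= k ^+ n * q.
  apply: le_trans (dist n j t) _; rewrite ler_piMr//.
  by rewrite gerBl exprn_ge0.
have kto0 e : 0 < e -> exists n, k ^+ n * q < e.
  move=> e0.
  have : (fun n => k ^+ n * q) @ \oo --> (0 : R).
    rewrite -[X in _ --> X](mul0r q); apply: cvgM; last exact: cvg_cst.
    by apply: cvg_expr; rewrite ger0_norm.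
  move/cvgrPdist_lt => /(_ e e0)[n _ /(_ n (leqnn n))] /=;
    rewrite sub0r normrN => h.
  by exists n; apply: le_lt_trans (ler_norm _) h.
have cvgu t : cvg (u ^~ t @ \oo).
  apply/cauchy_cvgP/cauchy_exP => e e0.
  have [n ne] := kto0 e e0; exists (u n t); exists n => // j /= nj.
  rewrite /ball/= distrC -(subnKC nj); exact: le_lt_trans (dist' _ _ _) ne.
pose v t := lim (u ^~ t @ \oo).
have vu n t : `|v t - u n t| <= k ^+ n * q.
  apply/ler_addgt0Pr => e e0.
  have : u ^~ t @ \oo --> v t by exact: cvgu.
  move/cvgrPdist_le => /(_ e e0)[N _ /(_ (n + N)%N (leq_addl n N))] /= h.
  rewrite (_ : _ - _ = (u (n + N)%N t - u n t) + (v t - u (n + N)%N t));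
    last by ring.
  by apply: le_trans (ler_normD _ _) _; apply: lerD.
have cv : continuous v.
  move=> t; apply/cvgrPdist_le => /= e e0.
  have e30 : 0 < e / 3 by rewrite divr_gt0.
  have [n ne] := kto0 _ e30.
  have := continuous_near_le t (proj1 (Du n)) e30.
  apply: filterS => s h.
  rewrite (_ : _ - _ = (v t - u n t) + (u n t - u n s) - (v s - u n s));
    last by ring.
  apply: le_trans (ler_normB _ _) _.
  have h1 := ler_normD (v t - u n t) (u n t - u n s).
  have h2 := vu n t; have h3 := vu n s; lra.
have pv : periodic v T.
  move=> t; rewrite /v (_ : u ^~ (t + T) = u ^~ t)//; apply/funext => n.
  by case: (Du n) => _ ->.
exists v; split => //; apply/funext => t; apply/eqP;
  rewrite -subr_eq0 -normr_le0.
apply/ler_addgt0Pr => e e0; rewrite add0r.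
have e30 : 0 < e / 2 by rewrite divr_gt0.
have [n ne] := kto0 _ e30.
have h1 : `|F (u n) t - F v t| <= k * (k ^+ n * q).
  by apply: FFu => // s; rewrite distrC.
have h2 := vu n.+1 t.
have h3 : k * (k ^+ n * q) <= k ^+ n * q by rewrite ler_piMl// ltW.
rewrite exprS -mulrA in h2.
rewrite (_ : _ - _ = - (F (u n) t - F v t) - (v t - u n.+1 t));
  last by rewrite /=; ring.
apply: le_trans (ler_normB _ _) _; rewrite normrN; lra.
Qed.

End Contraction.

Section SemilinearExistence.
Context {R : realType} (T c m : R) (E : R -> R).
Hypotheses (T0 : 0 < T) (cE : continuous E) (pE : periodic E T).

(** Let r1 and r2 be the roots of r^2 + c r - lam, so that u'' + c u' - lam u is
    the composition of the two operators d/dt - r. Solving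
    u'' + c u' - lam u = E' + m - g(u) - lam u for the left-hand u by two
    resolvents gives an operator whose Lipschitz constant is at most
    (lam - eta) / (|r1| |r2|) = (lam - eta) / lam < 1, because s |-> g s + lam s
    is nondecreasing with slope at most lam - eta. Shifting y = E + y1 keeps E
    undifferentiated, at the cost of the term r1 E. *)
Lemma semilinear_existence (g : R -> R) (lam eta : R) : continuous g ->
  0 < eta ->
  (forall a b, a <= b -> eta * (b - a) <= g a - g b <= lam * (b - a)) ->
  exists u z : R -> R, [/\ periodic u T,
    derives u (fun t => z t + E t - c * u t) & derives z (fun t =>
      m - g (u t))].
Proof.
move=> cg eta0 gb.
have lam0 : 0 < lam.
  by have /andP[] := gb 0 1 ler01; rewrite subr0 !mulr1; lra.
have eta_lam : eta <= lam.
  by have /andP[] := gb 0 1 ler01; rewrite subr0 !mulr1; lra.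
pose D : R := Num.sqrt (c ^+ 2 + 4 * lam).
have D2 : D ^+ 2 = c ^+ 2 + 4 * lam
  by rewrite sqr_sqrtr// addr_ge0 ?sqr_ge0// ltW// mulr_gt0.
pose r1 : R := (- c + D) / 2; pose r2 : R := (- c - D) / 2.
have rs : r1 + r2 = - c by rewrite /r1 /r2; field.
have rp : r1 * r2 = - lam.
  rewrite (_ : r1 * r2 = (c ^+ 2 - D ^+ 2) / 4); first by rewrite D2; field.
  by rewrite /r1 /r2; field.
have r10 : r1 != 0 by apply/eqP => h; move: rp; rewrite h mul0r; lra.
have r20 : r2 != 0 by apply/eqP => h; move: rp; rewrite h mulr0; lra.
pose N (u : R -> R) t := r1 * E t + m - g (u t) - lam * u t.
pose Y u := resolvent T r1 (N u).
pose F u := resolvent T r2 (fun t => E t + Y u t).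
have cN u : continuous u -> continuous (N u).
  move=> cu; apply: continuous_sub; last exact: continuous_scale.
  apply: continuous_sub; last exact: continuous_compose.
  by apply: continuous_add; [exact: continuous_scale|exact: continuous_const].
have pN u : periodic u T -> periodic (N u) T by move=> pu t; rewrite /N pE pu.
have DY u : continuous u -> derives (Y u) (fun t => r1 * Y u t + N u t).
  by move=> cu; apply: resolvent_der; exact: cN.
have cY u : continuous u -> continuous (Y u) by move=> /DY;
  exact: der_continuous.
have pY u : continuous u -> periodic u T -> periodic (Y u) T.
  by move=> cu pu; apply: resolvent_periodic => //; [exact: cN|exact: pN].
have cEY u : continuous u -> continuous (fun t => E t + Y u t).
  by move=> cu; apply: continuous_add => //; exact: cY.
have DFu u : continuous u -> derives (F u) (fun t =>
  r2 * F u t + (E t + Y u t)).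
  by move=> cu; apply: resolvent_der; exact: cEY.
have pEY u : continuous u -> periodic u T -> periodic (fun t => E t + Y u t) T.
  by move=> cu pu t; rewrite pE pY.
have cF u : continuous u -> continuous (F u) by move=> /DFu;
  exact: der_continuous.
have pF u : continuous u -> periodic u T -> periodic (F u) T.
  by move=> cu pu; apply: resolvent_periodic => //; [exact: cEY|exact: pEY].
pose k := (lam - eta) / lam.
have Nb u v M : (forall t, `|u t - v t| <= M) ->
  forall t, `|N u t - N v t| <= (lam - eta) * M.
  move=> uv t; rewrite /N.
  have M0 : 0 <= M by apply: le_trans (uv t).
  have := uv t; rewrite !ler_norml => /andP[h1 h2].
  have [h|h] := orP (le_total (u t) (v t)).
    have /andP[g1 g2] := gb _ _ h; apply/andP; split; nra.
  have /andP[g1 g2] := gb _ _ h; apply/andP; split; nra.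
have Fb u v M : continuous u -> periodic u T -> continuous v -> periodic v T ->
     (forall t, `|u t - v t| <= M) -> forall t, `|F u t - F v t| <= k * M.
  move=> cu pu cv pv uv t.
  have Yb s : `|Y u s - Y v s| <= (lam - eta) * M / `|r1|.
    by apply: resolvent_bound => //;
      [exact: cN|exact: cN|exact: pN|exact: pN|exact: Nb].
  have -> : k * M = (lam - eta) * M / `|r1| / `|r2|.
    have -> : k * M = (lam - eta) * M / `|r1 * r2|.
      by rewrite rp normrN gtr0_norm// /k; field; lra.
    by rewrite normrM invfM mulrA.
  apply: resolvent_bound => //; [exact: cEY|exact: cEY|exact: pEY|exact: pEY|].
  move=> s; rewrite (_ : _ - _ = Y u s - Y v s); last by ring.
  exact: Yb.
have c0 : continuous (fun _ : R => 0 : R) by exact: continuous_const.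
have p00 : periodic (fun _ : R => 0 : R) T by [].
have [C HC] : exists C, forall t, `|F (fun=> 0) t| <= C.
  have [t0 _ H] := @periodic_max R T (fun t => `|F (fun=> 0) t|) T0 (fun t =>
    congr1 _ (pF _ c0 p00 t)) (continuous_normf (cF _ c0)).
  by exists `|F (fun=> 0) t0|.
have k01 : 0 <= k < 1.
  rewrite divr_ge0 ?subr_ge0 ?(ltW lam0)//= ltr_pdivrMr// mul1r; lra.
have [|u [cu pu uF]] := periodic_contraction k01 _ Fb HC.
  by move=> u cu pu; split; [exact: cF|exact: pF].
have Du : derives u (fun t => r2 * u t + (E t + Y u t)).
  by move=> t; have := DFu u cu t; rewrite uF.
(* From u' = r2 u + E + Y u and r1 + r2 = - c, this is u' + c u - E. *)
exists u, (fun t => Y u t - r1 * u t); split; [exact: pu|move=> t|move=> t].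
  apply: der_eq (Du t) _; rewrite (_ : c = - (r1 + r2)); first ring.
  by rewrite rs opprK.
apply: der_eq (derB (DY u cu t) (derZ r1 (Du t))) _; rewrite /N.
have -> : lam = - (r1 * r2) by rewrite rp opprK.
ring.
Qed.

End SemilinearExistence.

(** * A priori estimates *)

Section Estimates.
Context {R : realType} (T c : R) (e : R -> R).
Hypotheses (T0 : 0 < T) (e_loc : locint e)
  (e2_loc : locint (fun x => e x ^+ 2))
  (pE : periodic (prim e) T).
Implicit Types (m a b x y k r s t : R) (f df g u v w z h : R -> R).
Local Notation E := (prim e).
Local Notation T2 := (2 * T).

(** Integrate Young's inequality |f| <= (th f^2 + 1/th) / 2 over [s, t], with th
    the square root of t - s. *)
Lemma prim_holder f s t : locint f -> locint (fun x => f x ^+ 2) -> s < t ->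
  `|prim f t - prim f s| <=
  Num.sqrt (t - s) * ((1 + (prim (fun x => f x ^+ 2) t - prim (fun x =>
    f x ^+ 2) s)) / 2).
Proof.
move=> lf lf2 st.
pose th : R := Num.sqrt (t - s).
have th0 : 0 < th by rewrite sqrtr_gt0 subr_gt0.
have th2 : th ^+ 2 = t - s by rewrite sqr_sqrtr// subr_ge0 ltW.
apply: (le_trans (prim_norm lf (ltW st))).
pose g x := th / 2 * f x ^+ 2 + (2 * th)^-1.
have lc : locint (fun=> (2 * th)^-1)
  by apply/continuous_locint/continuous_const.
have lg : locint g by apply: locintD => //; exact: locintZ.
apply: (@le_trans _ _ (prim g t - prim g s)).
  apply: prim_le => //; [exact: locint_norm|exact: ltW|].
  move=> x _; rewrite /g.
  have := sqr_ge0 (th * `|f x| - 1).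
  rewrite -[f x ^+ 2]real_normK ?num_real//; set y := `|f x| => h.
  have -> : th / 2 * y ^+ 2 + (2 * th)^-1 = y + (th * y - 1) ^+ 2 / (2 * th)
    by field; lra.
  by rewrite lerDl divr_ge0// ltW// mulr_gt0.
rewrite /g !primD//; try exact: locintZ.
rewrite !primZ// !prim_cst -/th.
set p1 := prim _ t; set p2 := prim _ s.
have -> : th / 2 * p1 + (2 * th)^-1 * t - (th / 2 * p2 + (2 * th)^-1 * s) =
  th / 2 * (p1 - p2) + th ^+ 2 / (2 * th) by rewrite th2; field; lra.
have -> : th ^+ 2 / (2 * th) = th / 2 by field; lra.
lra.
Qed.

Lemma prim_halves f g x : locint f -> locint g ->
  prim (fun t => 2^-1 * f t + 2^-1 * g t) x = 2^-1 * prim f x + 2^-1 * prim g x.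
Proof.
by move=> lf lg; rewrite (primD _ (locintZ _ lf) (locintZ _ lg)) (primZ _ _ lf)
  (primZ _ _ lg).
Qed.

Lemma continuous_sqr f : continuous f -> continuous (fun x => f x ^+ 2).
Proof. by move=> cf; apply: continuous_mul. Qed.

(** The constants below are taken over two periods: a period that starts at a
    point of [0, T] stays in [0, 2 T]. *)
Definition slope_bound : R := prim (fun t => E t ^+ 2) T2.
Definition force_bound : R := prim (fun t => e t ^+ 2) T2.
Definition osc_bound : R := Num.sqrt T2 * ((1 + slope_bound) / 2).

Lemma continuous_forcing : continuous E.
Proof. exact: continuous_prim. Qed.

Lemma T2_gt0 : 0 < T2.
Proof. by rewrite mulr_gt0. Qed.

Lemma periodic_T2 f : periodic f T -> f T2 = f 0.
Proof. by move=> pf; rewrite -[in RHS]pf -[in RHS]pf; congr f; ring. Qed.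

Lemma prim_ge0 f a b : locint f -> a <= b -> (forall x, 0 <= f x) ->
  prim f a <= prim f b.
Proof.
move=> lf ab f0; have l0 : locint (fun=> 0 : R)
  by apply/continuous_locint/continuous_const.
have := prim_le l0 lf ab (fun x _ => f0 x); rewrite !prim_cst; lra.
Qed.

Lemma prim_sqr_window f K s t : locint (fun x => f x ^+ 2) ->
  prim (fun x => f x ^+ 2) T2 <= K ->
  0 <= s -> s <= t -> t <= T2 ->
  prim (fun x => f x ^+ 2) t - prim (fun x => f x ^+ 2) s <= K.
Proof.
move=> lf fK s0 st tT.
have h1 := prim_ge0 lf tT (fun x => sqr_ge0 (f x)).
have h2 := prim_ge0 lf s0 (fun x => sqr_ge0 (f x)).
have := prim0 (fun x => f x ^+ 2); lra.
Qed.

Lemma slope_bound_ge0 : 0 <= slope_bound.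
Proof.
rewrite /slope_bound -(prim0 (fun t => E t ^+ 2)); apply: prim_ge0 => //.
- exact/continuous_locint/continuous_sqr/continuous_forcing.
- exact/ltW/T2_gt0.
- by move=> x; rewrite sqr_ge0.
Qed.

Lemma force_bound_ge0 : 0 <= force_bound.
Proof.
rewrite /force_bound -(prim0 (fun t => e t ^+ 2)); apply: prim_ge0 => //.
- exact/ltW/T2_gt0.
- by move=> x; rewrite sqr_ge0.
Qed.

Section slope.
Variables (u z h : R -> R) (a : R).
Hypotheses (pu : periodic u T) (Du : derives u (fun t => z t + E t - c * u t))
  (Dz : derives z h) (ch : continuous h) (uh : forall t, 0 <= (u t - a) * h t).
Let du t := z t + E t - c * u t.

Lemma continuous_slope : continuous du.
Proof.
apply: continuous_sub; last exact/continuous_scale/(der_continuous Du).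
by apply: continuous_add; [exact: der_continuous Dz|exact: continuous_forcing].
Qed.

(** Multiply z' = h by u - a and integrate by parts over two periods:
    the integral of u'^2 is that of u' E minus that of (u - a) h, and the latter is
    nonnegative. The friction term c u u' is the derivative of c u^2 / 2. *)
Lemma slope_estimate : prim (fun t => du t ^+ 2) T2 <= slope_bound.
Proof.
have cu := der_continuous Du; have cz := der_continuous Dz.
have pz := momentum_periodic pE pu Du.
(* dW = u'^2 - u' E + (u - a) h, and W is periodic. *)
pose W t := (u t - a) * z t - c / 2 * (u t * u t).
pose dW t := du t * z t + (u t - a) * h t - c * (u t * du t).
have DW : derives W dW.
  move=> t; apply: der_eq (derB (derM (derB (Du t) (derC a t)) (Dz t)) (derZ
    (c / 2) (derM (Du t) (Du t)))) _.
  by rewrite /dW -/(du t); field.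
have cdW : continuous dW.
  have c1 := continuous_slope.
  apply: continuous_sub; last by apply: continuous_scale; exact: continuous_mul.
  apply: continuous_add; first exact: continuous_mul.
  by apply: continuous_mul => //; apply: continuous_sub => //;
    exact: continuous_const.
have l1 : locint (fun t => du t ^+ 2)
  by exact/continuous_locint/continuous_sqr/continuous_slope.
have l2 : locint (fun t => E t ^+ 2)
  by exact/continuous_locint/continuous_sqr/continuous_forcing.
have l3 := continuous_locint cdW.
pose g t := 2^-1 * du t ^+ 2 + 2^-1 * E t ^+ 2 + dW t.
have lg : locint g by apply: locintD => //; apply: locintD; exact: locintZ.
have pointwise x : du x ^+ 2 <= g x.
  rewrite /g /dW.
  have -> : z x = du x + c * u x - E x by rewrite /du; ring.
  have := uh x; have := sqr_ge0 (du x - E x); rewrite !expr2; lra.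
have := prim_le l1 lg (ltW T2_gt0) (fun x _ => pointwise x).
have gE x : prim g x = 2^-1 * prim (fun t =>
  du t ^+ 2) x + 2^-1 * prim (fun t => E t ^+ 2) x + prim dW x.
  by rewrite (primD _ _ l3) ?(prim_halves _ l1 l2)//; apply: locintD;
    exact: locintZ.
rewrite !gE !prim0.
have := @prim_der _ _ _ 0 T2 DW cdW; rewrite prim0.
have -> : W T2 = W 0 by rewrite /W (periodic_T2 pu) (periodic_T2 pz).
rewrite /slope_bound; lra.
Qed.

Lemma slope_holder s t : 0 <= s -> s < t -> t <= T2 ->
  `|u t - u s| <= Num.sqrt (t - s) * ((1 + slope_bound) / 2).
Proof.
move=> s0 st tT.
have l1 : locint (fun t => du t ^+ 2)
  by exact/continuous_locint/continuous_sqr/continuous_slope.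
rewrite -(prim_der s t Du continuous_slope);
  apply: le_trans (prim_holder (continuous_locint continuous_slope) l1 st) _.
apply: ler_wpM2l; first exact: sqrtr_ge0.
have := prim_sqr_window l1 slope_estimate s0 (ltW st) tT; lra.
Qed.

Lemma oscillation s t : `|u t - u s| <= osc_bound.
Proof.
have [s' /andP[s0 sT] ->//] := periodic_range s T0.
have [t' /andP[t0 tT] ->//] := periodic_range t T0.
have osc0 : 0 <= osc_bound by rewrite mulr_ge0 ?sqrtr_ge0//;
  have := slope_bound_ge0; lra.
have W x y : 0 <= x -> x < y -> y <= T -> `|u y - u x| <= osc_bound.
  move=> x0 xy yT; apply: le_trans (slope_holder x0 xy _) _; first by lra.
  rewrite /osc_bound; apply: ler_wpM2r; first by have := slope_bound_ge0; lra.
  by rewrite ler_wsqrtr//; lra.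
have [st|ts|->] := ltgtP s' t'; first exact: W.
  by rewrite distrC; exact: W.
by rewrite subrr normr0.
Qed.

End slope.

Section curvature.
Variables (g dg u z : R -> R) (a m : R).
Hypotheses (Dg : derives g dg) (cdg : continuous dg) (dg0 : forall x,
  dg x <= 0) (ga : g a = m).
Hypotheses (pu : periodic u T) (Du : derives u (fun t => z t + E t - c * u t))
  (Dz : derives z (fun t => m - g (u t))).
Let du t := z t + E t - c * u t.
Let G t := g (u t) - m.

Lemma monotone_force t : 0 <= (u t - a) * (m - g (u t)).
Proof.
have mono x y : x <= y -> g y <= g x.
  move=> xy; rewrite -lerN2.
  by apply: (der_le (fun x _ => derN (Dg x))) => // w _; rewrite oppr_ge0.
rewrite -ga; have [h|h] := orP (le_total (u t) a); have := mono _ _ h => h'.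
  by rewrite mulr_le0// subr_le0.
by rewrite mulr_ge0// subr_ge0.
Qed.

Lemma continuous_restoring : continuous (fun t => m - g (u t)).
Proof.
apply: continuous_sub; first exact: continuous_const.
by apply: continuous_compose;
  [exact: der_continuous Du|exact: der_continuous Dg].
Qed.

(** Multiply z' = m - g(u) by G = g(u) - m: the integral of G^2 is that of
    g'(u) u'^2 <= 0, minus that of G' E, plus boundary terms and the friction term
    c g'(u) u u', which is the derivative of a function of u. Since E' = e in the
    weak sense, - G' E integrates to the same value as G e, which is at most
    half of G^2 plus half of e^2. *)
Lemma curvature_estimate : prim (fun t => G t ^+ 2) T2 <= force_bound.
Proof.
have cu := der_continuous Du; have cz := der_continuous Dz.
have pz := momentum_periodic pE pu Du.
have cdu' : continuous du by exact: continuous_slope Du Dz.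
have csdg : continuous (fun s => s * dg s) by apply: continuous_mul => // x;
  exact: cvg_id.
(* Gam(u) absorbs the friction term: its derivative is u g'(u) u'. *)
pose Gam := prim (fun s => s * dg s).
have DGam : derives Gam (fun s => s * dg s).
  by move=> x; apply: is_derive_prim; [exact: continuous_locint|exact: csdg].
pose dG t := dg (u t) * du t.
have DG : derives G dG.
  by move=> t; apply: der_eq (derB (der_comp (Du t) (Dg (u t))) (derC m t)) _;
    rewrite subr0.
have cdgu : continuous (fun t => dg (u t)) by exact: continuous_compose.
have cdG : continuous dG by exact: continuous_mul.
have cG := der_continuous DG.
pose W t := c * Gam (u t) - G t * z t.
pose dW t := c * (u t * dg (u t) * du t) - (dG t * z t + G t * (m - g (u t))).
have DW : derives W dW.
  by move=> t; apply: der_eq (derB (derZ c (der_comp (Du t) (DGam (u t)))) (derM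
    (DG t) (Dz t))) _.
have cdW : continuous dW.
  apply: continuous_sub; first by apply/continuous_scale;
    apply: continuous_mul => //; apply: continuous_mul.
  by apply: continuous_add; apply: continuous_mul => //;
    exact: continuous_restoring.
have l1 : locint (fun t => G t ^+ 2) by exact/continuous_locint/continuous_sqr.
have l3 := continuous_locint cdW.
have l4 : locint (fun t => dG t * E t).
  by apply: locintM => //; exact/continuous_locint/continuous_forcing.
have l5 : locint (fun t => G t * e t) by exact: locintM.
have ibp := prim_by_parts T2 e_loc DG cdG.
have E2 : E T2 = 0 by rewrite periodic_T2// prim0.
rewrite E2 mulr0 (primD _ l4 l5) in ibp.
pose f t := dW t - dG t * E t.
have lf : locint f by exact: locintB.
(* f = G^2 - g'(u) u'^2. *)
have excess_le x : G x ^+ 2 <= f x.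
  rewrite /f /dW /dG.
  have -> : z x = du x + c * u x - E x by rewrite /du; ring.
  rewrite (_ : m - g (u x) = - G x); last by rewrite /G; ring.
  have : dg (u x) * du x ^+ 2 <= 0 by rewrite mulr_le0_ge0 ?sqr_ge0.
  rewrite !expr2; lra.
have := prim_le l1 lf (ltW T2_gt0) (fun x _ => excess_le x).
pose q t := 2^-1 * G t ^+ 2 + 2^-1 * e t ^+ 2.
have lq : locint q by apply: locintD; exact: locintZ.
have young x : G x * e x <= q x.
  by rewrite /q; have := sqr_ge0 (G x - e x); rewrite !expr2; lra.
have := prim_le l5 lq (ltW T2_gt0) (fun x _ => young x).
rewrite (primB _ l3 l4) (primB 0 l3 l4) (prim_halves _ l1 e2_loc)
  (prim_halves 0 l1 e2_loc) !prim0.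
have := @prim_der _ _ _ 0 T2 DW cdW; rewrite prim0.
have -> : W T2 = W 0 by rewrite /W /G (periodic_T2 pu) (periodic_T2 pz).
rewrite /force_bound; move: ibp; set i1 := prim _ _; set i2 := prim _ _;
  set i3 := prim _ _; lra.
Qed.

Definition slope_holder_bound : R :=
  (1 + force_bound) + `|c| * ((1 + slope_bound) / 2).

(** Each term of u' = z + E - c u is a primitive of a function with bounded L^2
    norm: g(u) - m up to sign, e, and c u'. *)
Lemma slope_holder_half s t : 0 <= s -> s < t -> t <= T2 ->
  `|du t - du s| <= slope_holder_bound * Num.sqrt (t - s).
Proof.
move=> s0 st tT.
have H1 := slope_holder pu Du Dz continuous_restoring monotone_force s0 st tT.
have H2 := prim_holder e_loc e2_loc st.
have w2 := @prim_sqr_window e force_bound s t e2_loc (lexx _) s0 (ltW st) tT.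
have cG : continuous G.
  by apply: continuous_sub; [apply: continuous_compose;
    [exact: der_continuous Du|exact: der_continuous Dg]|exact:
    continuous_const].
have l1 : locint (fun t => G t ^+ 2) by exact/continuous_locint/continuous_sqr.
have H3 := prim_holder (continuous_locint cG) l1 st.
have w3 := prim_sqr_window l1 curvature_estimate s0 (ltW st) tT.
set q := Num.sqrt (t - s) in H1 H2 H3 *.
have q0 : 0 <= q by exact: sqrtr_ge0.
have {w2}H2 : `|E t - E s| <= q * ((1 + force_bound) / 2).
  by apply: le_trans H2 _; apply: ler_wpM2l => //; lra.
have {w3}H3 : `|z t - z s| <= q * ((1 + force_bound) / 2).
  rewrite -(prim_der s t Dz continuous_restoring).
  have -> : prim (fun t => m - g (u t)) t - prim (fun t =>
    m - g (u t)) s = - (prim G t - prim G s).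
    rewrite (_ : (fun t => m - g (u t)) = (fun t => -1 * G t));
      last by apply/funext => x; rewrite /G; ring.
    by rewrite !primZ; try exact: continuous_locint; ring.
  by rewrite normrN; apply: le_trans H3 _; apply: ler_wpM2l => //; lra.
rewrite (_ : du t - du s = (z t - z s) + (E t - E s) - c * (u t - u s));
  last by rewrite /du; ring.
apply: le_trans (ler_normB _ _) _.
have := ler_normD (z t - z s) (E t - E s).
have : `|c * (u t - u s)| <= `|c| * (q * ((1 + slope_bound) / 2))
  by rewrite normrM ler_wpM2l.
rewrite /slope_holder_bound; lra.
Qed.

(** At the minimum u' = 0, so u' is at most a multiple of the square root of the
    distance to t0. *)
Lemma growth_from_min t0 s : 0 <= t0 <= T -> (forall t, u t0 <= u t) ->
  0 < s <= T ->
  u (t0 + s) <= u t0 + slope_holder_bound * (s * Num.sqrt s).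
Proof.
move=> /andP[h1 h2] Hm /andP[s0 sT].
have d0 : du t0 = 0 := der_at_min Du Hm.
have st : t0 < t0 + s by rewrite ltrDl.
have [x /andP[x1 x2]] := der_mvt (fun x _ => Du x) st.
rewrite (_ : t0 + s - t0 = s); last by ring.
rewrite -/(du x) => Eq.
have : `|du x - du t0| <= slope_holder_bound * Num.sqrt (x - t0)
  by apply: slope_holder_half => //; lra.
rewrite d0 subr0 => H.
have hK0 : 0 <= slope_holder_bound.
  rewrite addr_ge0 ?mulr_ge0//; first by have := force_bound_ge0; lra.
  by have := slope_bound_ge0; lra.
have : slope_holder_bound * Num.sqrt
  (x - t0) <= slope_holder_bound * Num.sqrt s.
  by apply: ler_wpM2l => //; rewrite ler_wsqrtr//; lra.
have := ler_norm (du x) => k1 k2.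
rewrite -lerBlDl Eq mulrC mulrCA; apply: ler_wpM2l; first exact: ltW.
lra.
Qed.

End curvature.

End Estimates.

(** * Regularisation of the singular nonlinearity *)

Section Regularisation.
Context {R : realType} (p eps M : R).
Hypotheses (p0 : 0 < p) (eps0 : 0 < eps) (eps1 : eps <= 1) (M1 : 1 <= M).
Implicit Types (a b s x : R).

Definition clamp s : R := Num.max eps (Num.min s M).

Lemma clamp_range s : eps <= clamp s <= M.
Proof.
have epsM : eps <= M by exact: le_trans eps1 M1.
by rewrite /clamp le_max lexx ge_max epsM ge_min lexx orbT.
Qed.

Lemma clamp_gt0 s : 0 < clamp s.
Proof. by have /andP[h _] := clamp_range s; exact: lt_le_trans eps0 h. Qed.

Lemma clamp_id s : eps <= s <= M -> clamp s = s.
Proof. by move=> /andP[h1 h2]; rewrite /clamp (min_l h2) (max_r h1). Qed.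

Lemma continuous_clamp : continuous clamp.
Proof.
move=> x; apply: (@continuous_max R R (cst eps) (fun x => Num.min x M));
  first exact: cvg_cst.
by apply: (@continuous_min R R id (cst M)); [exact: cvg_id|exact: cvg_cst].
Qed.

Definition dtame s : R := - (p * (clamp s `^ (p + 1))^-1).

Lemma continuous_dtame : continuous dtame.
Proof.
apply: continuous_opp; apply: continuous_scale; apply: continuous_invpow.
  exact: continuous_clamp.
exact: clamp_gt0.
Qed.

Lemma dtame_bound s : - (p * (eps `^ (p + 1))^-1) <= dtame s <= - (p * (M `^
  (p + 1))^-1).
Proof.
have /andP[h1 h2] := clamp_range s; have p1 : 0 < p + 1 by rewrite addr_gt0.
by rewrite /dtame !lerN2 !ler_pM2l//; apply/andP; split; apply: invpow_le => //;
  exact: clamp_gt0.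
Qed.

Lemma dtame_le0 s : dtame s <= 0.
Proof. by rewrite oppr_le0 mulr_ge0 ?invr_ge0 ?powR_ge0// ltW. Qed.

(** The C^1 extension of s^-p outside [eps, M] by tangent lines, defined by
    integrating the clamped slope from 1, where its value is 1. *)
Definition tame s : R := 1 + (prim dtame s - prim dtame 1).

Lemma tame_der : derives tame dtame.
Proof.
move=> x; have c := continuous_dtame.
apply: der_eq (derD (derC 1 x) (derB (is_derive_prim (continuous_locint c)
  (c x)) (derC (prim dtame 1) x))) _.
by rewrite add0r subr0.
Qed.

Lemma tame_slopes a b : a <= b ->
  p * (M `^ (p + 1))^-1 * (b - a) <= tame a - tame b <= p * (eps `^
    (p + 1))^-1 * (b - a).
Proof.
rewrite le_eqVlt => /predU1P[->|ab]; first by rewrite !subrr !mulr0 lexx.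
have [x _ Ex] := der_mvt (fun x _ => tame_der x) ab.
have /andP[h1 h2] := dtame_bound x.
have -> : tame a - tame b = - dtame x * (b - a) by rewrite mulNr -Ex; ring.
by apply/andP; split; apply: ler_wpM2r; rewrite ?subr_ge0//; lra.
Qed.

Lemma tame_antitone a b : a <= b -> tame b <= tame a.
Proof.
move=> ab; rewrite -subr_ge0; apply: le_trans (proj1 (andP (tame_slopes ab))).
by rewrite mulr_ge0 ?subr_ge0// mulr_ge0 ?invr_ge0 ?powR_ge0// ltW.
Qed.

Lemma tame_le_reflect a b : tame b <= tame a -> a <= b.
Proof.
move=> h; rewrite leNgt; apply/negP => ba.
have /andP[h1 _] := tame_slopes (ltW ba).
suff : 0 < p * (M `^ (p + 1))^-1 * (a - b) by lra.
by rewrite mulr_gt0 ?subr_gt0// mulr_gt0 ?invr_gt0 ?powR_gt0//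
  (lt_le_trans ltr01 M1).
Qed.

Lemma tame_invpow_cst a b : eps <= a -> a <= b -> b <= M ->
  tame a - (a `^ p)^-1 = tame b - (b `^ p)^-1.
Proof.
move=> ea ab bM.
have D (x : R) : a <= x <= b ->
  is_derive x 1 (fun s => tame s - (s `^ p)^-1) ((fun=> 0 : R) x).
  move=> /andP[ax xb]; have x0 : 0 < x
    by apply: lt_le_trans eps0 (le_trans ea ax).
  have Dp := is_derive1_powR (- p) x0.
  rewrite (_ : (@powR R) ^~ (- p) = fun s => (s `^ p)^-1) in Dp;
    last by apply/funext => s; rewrite powRN.
  apply: der_eq (derB (tame_der x) Dp) _.
  rewrite /dtame clamp_id; last by rewrite (le_trans ea ax) (le_trans xb bM).
  by rewrite -powRN opprD; ring.
move: ab; rewrite le_eqVlt => /predU1P[->//|ab].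
have [x _] := der_mvt D ab; rewrite mul0r => /eqP;
  rewrite subr_eq0 => /eqP ->//.
Qed.

Lemma tameE s : eps <= s <= M -> tame s = (s `^ p)^-1.
Proof.
move=> /andP[es sM].
have r1 : tame 1 = 1 by rewrite /tame subrr addr0.
have i1 : ((1 : R) `^ p)^-1 = 1 by rewrite powR1 invr1.
have [h|h] := orP (le_total s 1).
  have := tame_invpow_cst es h M1; rewrite r1 i1; lra.
have := tame_invpow_cst eps1 h sM; rewrite r1 i1; lra.
Qed.

End Regularisation.

(** * Existence for the singular equation *)

Section Existence.
Context {R : realType} (T p c : R) (e : R -> R).
Hypotheses (T0 : 0 < T) (p3 : 3^-1 <= p) (e_loc : locint e)
  (e2_loc : locint (fun x => e x ^+ 2))
  (pE : periodic (prim e) T).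
Implicit Types (m a b x y k r s t : R) (f df g u v w z h : R -> R).
Local Notation E := (prim e).

Lemma p_gt0 : 0 < p.
Proof. by apply: lt_le_trans p3; rewrite invr_gt0. Qed.

(** The exponent 3 p of s in the left-hand side is at least 1. *)
Lemma critical_power s : 0 < s <= 1 -> ((s * Num.sqrt s) `^ p) ^+ 2 <= s.
Proof.
move=> /andP[s0 s1].
have s3 : (s * Num.sqrt s) * (s * Num.sqrt s) = s ^+ 3.
  by rewrite mulrACA -!expr2 sqr_sqrtr ?ltW// -exprSr.
have q0 : 0 <= s * Num.sqrt s by rewrite mulr_ge0 ?sqrtr_ge0 ?ltW.
rewrite expr2 -powRM// s3.
have -> : s ^+ 3 = s `^ 3%:R by rewrite powR_mulrn// ltW.
rewrite -powRrM -[leRHS]powRr1; last exact: ltW.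
apply: ger_powR; first by rewrite s0.
by have := p3; lra.
Qed.

(** Suppose the minimum u(t0) is at most eps = sig^(3/2). By [growth_from_min],
    u(t0 + s) <= (1 + D) s^(3/2) for sig <= s <= s1, so the square of the force is
    at least kk / s by [critical_power]. Its integral over this range is at least
    kk (ln s1 - ln sig), which the choice of sig makes larger than the bound given
    by [curvature_estimate]. *)
Lemma positivity_of_minimum m u z eps M sig : 0 < m -> 0 < sig -> sig <= 1 ->
  sig <= T ->
  eps = sig * Num.sqrt sig -> eps <= 1 -> 1 + slope_holder_bound T c e <= M ->
  let s1 := Num.min 1 T in
  let kk := (((1 + slope_holder_bound T c e) `^ p)^-1) ^+ 2 in
  kk * (ln s1 - ln sig) > 2 * force_bound T e + 4 * m ^+ 2 * T ->
  periodic u T -> derives u (fun t => z t + E t - c * u t) ->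
  derives z (fun t => m - tame p eps M (u t)) ->
  (exists a, tame p eps M a = m) ->
  forall t, eps < u t.
Proof.
have Tpos := T0; move=> m0 sig0 sig1 sigT epsE eps1 DM s1 kk Hkk pu Du Dz [a
  ga].
set g := tame p eps M in Dz ga.
have eps0 : 0 < eps by rewrite epsE mulr_gt0 ?sqrtr_gt0.
have hK0 : 0 <= slope_holder_bound T c e.
  rewrite /slope_holder_bound addr_ge0 ?mulr_ge0//;
    first by have := force_bound_ge0 T0 e2_loc; lra.
  by have := slope_bound_ge0 T0 e_loc; lra.
have M1 : 1 <= M by lra.
have pp := p_gt0.
have cu := der_continuous Du.
have Dg := tame_der p eps0 eps1 M1.
have cg : continuous g := der_continuous Dg.
have [t0 t0T Hmin] := periodic_min T0 pu cu.
suff : eps < u t0 by move=> h t; exact: lt_le_trans (Hmin t).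
rewrite ltNge; apply/negP => ut0.
have s10 : 0 < s1 by rewrite lt_min ltr01.
have s11 : s1 <= 1 by rewrite ge_min lexx.
have s1T : s1 <= T by rewrite ge_min lexx orbT.
have sigs1 : sig <= s1 by rewrite le_min sig1.
pose F t := g (u t).
have cF : continuous F by exact: continuous_compose.
have cF2 := continuous_sqr cF.
have lF2 := continuous_locint cF2.
have kk0 : 0 < kk by rewrite exprn_gt0// invr_gt0 powR_gt0//; lra.
have Fb s : sig <= s <= s1 -> kk / s <= F (t0 + s) ^+ 2.
  move=> /andP[ss ss1]; have s0 : 0 < s := lt_le_trans sig0 ss.
  have sT : 0 < s <= T by rewrite s0 (le_trans ss1).
  have := growth_from_min T0 e_loc e2_loc pE Dg (continuous_dtame eps0 eps1 M1)
    (dtame_le0 eps M pp) ga pu Du Dz t0T Hmin sT.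
  set D := slope_holder_bound T c e in hK0 DM kk kk0 Hkk * => ub.
  have qs : sig * Num.sqrt sig <= s * Num.sqrt s.
    by apply: ler_pM => //; rewrite ?sqrtr_ge0 ?ler_wsqrtr// ltW.
  have q0 : 0 < s * Num.sqrt s by rewrite mulr_gt0 ?sqrtr_gt0.
  have q1 : s * Num.sqrt s <= 1.
    rewrite -[leRHS]mulr1; apply: ler_pM; rewrite ?sqrtr_ge0 ?(ltW s0)//;
      first by lra.
    by rewrite -[leRHS]sqrtr1 ler_wsqrtr//; lra.
  set q := s * Num.sqrt s in ub qs q0 q1.
  pose y := (1 + D) * q.
  have uy : u (t0 + s) <= y by rewrite /y; rewrite -epsE in qs; lra.
  have ey : eps <= y.
    rewrite epsE (le_trans qs)// /y -[leLHS]mul1r; apply: ler_wpM2r;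
      [exact: ltW|lra].
  have yM : y <= M by rewrite /y; apply: le_trans DM; rewrite -[leRHS]mulr1;
    apply: ler_wpM2l => //; lra.
  have y0 : 0 < y := lt_le_trans eps0 ey.
  have gy : g y = (y `^ p)^-1 by apply: tameE => //; rewrite ey.
  have Fy : (y `^ p)^-1 <= F (t0 + s) by rewrite -gy;
    exact: (tame_antitone pp eps0 eps1 M1).
  have iy0 : 0 < (y `^ p)^-1 by rewrite invr_gt0 powR_gt0.
  apply: (@le_trans _ _ ((y `^ p)^-1 ^+ 2)); last by rewrite ler_sqr ?nnegrE//;
    lra.
  rewrite /y powRM; [|by lra|exact: ltW].
  rewrite invfM exprMn /kk -/D; apply: ler_wpM2l; first exact: sqr_ge0.
  rewrite exprVn lef_pV2 ?posrE ?exprn_gt0 ?powR_gt0//.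
  by apply: critical_power; rewrite s0 (le_trans ss1).
have [t00 t01] := andP t0T.
(* The primitive of F^2 grows at least as fast as kk ln(x - t0). *)
pose Q x := prim (fun t => F t ^+ 2) x - kk * ln (x - t0).
have DQ (x : R) : t0 + sig <= x <= t0 + s1 ->
  is_derive x 1 Q (F x ^+ 2 - kk / (x - t0)).
  move=> /andP[x1 x2].
  have xt : 0 < x - t0 by lra.
  have Dl := @der_comp _ (fun x =>
    x - t0) _ x _ _ (derB (derX x) (derC t0 x)) (is_derive1_ln xt).
  by apply: der_eq (derB (is_derive_prim lF2 (cF2 x)) (derZ kk Dl)) _;
    rewrite subr0 mulr1.
have : Q (t0 + sig) <= Q (t0 + s1).
  apply: der_le DQ _ _; last by lra.
  move=> x /andP[x1 x2]; rewrite subr_ge0 -[X in F X](subrKC t0); apply: Fb.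
  by apply/andP; split; lra.
rewrite /Q !(addrC t0) !addrK => Qle.
have w : prim (fun t => F t ^+ 2) (s1 + t0) - prim (fun t =>
  F t ^+ 2) (sig + t0) <= 2 * force_bound T e + 4 * m ^+ 2 * T.
  apply: (prim_sqr_window (T := T)) => //; [|by lra|by lra|by lra].
  pose G t := g (u t) - m.
  have cG : continuous G by apply: continuous_sub => //;
    exact: continuous_const.
  have lG := continuous_locint (continuous_sqr cG).
  have lc : locint (fun=> 2 * m ^+ 2)
    by apply/continuous_locint/continuous_const.
  have F_le x : F x ^+ 2 <= 2 * G x ^+ 2 + 2 * m ^+ 2.
    have -> : F x = G x + m by rewrite /F /G subrK.
    by have := sqr_ge0 (G x - m); rewrite !expr2; lra.
  have := prim_le lF2 (locintD (locintZ 2 lG) lc) (ltW (T2_gt0 T0)) (fun x _ =>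
    F_le x).
  rewrite !(primD _ (locintZ 2 lG) lc) !(primZ _ _ lG) !prim_cst !prim0.
  have := curvature_estimate T0 e_loc e2_loc pE Dg
    (continuous_dtame eps0 eps1 M1) (dtame_le0 eps M pp) pu Du Dz.
  rewrite -/g -/G; set i1 := prim _ _; set i2 := prim _ _; lra.
lra.
Qed.

Lemma level_exists m : 0 < m -> exists2 a, 0 < a & (a `^ p)^-1 = m.
Proof.
move=> m0; exists (m `^ (- p^-1)); first exact: powR_gt0.
rewrite -powRrM mulNr mulVf ?gt_eqF ?p_gt0//.
by rewrite powR_inv1 ?invrK// ltW.
Qed.

(** Choose sig, hence eps, small enough for [positivity_of_minimum], and M larger
    than the bound a + oscillation. The solution of the regularised problem then
    takes its values where the regularisation changes nothing. *)
Lemma existence m : 0 < m -> exists u, classical_solution T p c E m u.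
Proof.
have Tpos := T0; move=> m0; have pp := p_gt0.
have [a a0 am] := level_exists m0.
have hK0 : 0 <= slope_holder_bound T c e.
  rewrite /slope_holder_bound addr_ge0 ?mulr_ge0//;
    first by have := force_bound_ge0 T0 e2_loc; lra.
  by have := slope_bound_ge0 T0 e_loc; lra.
have oK0 : 0 <= osc_bound T e by rewrite mulr_ge0 ?sqrtr_ge0//;
  have := slope_bound_ge0 T0 e_loc; lra.
pose s1 : R := Num.min 1 T.
pose kk := (((1 + slope_holder_bound T c e) `^ p)^-1) ^+ 2.
have kk0 : 0 < kk by rewrite exprn_gt0// invr_gt0 powR_gt0//; lra.
pose N := 2 * force_bound T e + 4 * m ^+ 2 * T.
have s10 : 0 < s1 by rewrite lt_min ltr01.
have s11 : s1 <= 1 by rewrite ge_min lexx.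
have s1T : s1 <= T by rewrite ge_min lexx orbT.
(* With ln sig <= ln s1 - X the logarithmic integral exceeds the bound N. *)
pose X := (N + 1) / kk.
have N0 : 0 <= N.
  have := force_bound_ge0 T0 e2_loc;
    have : 0 <= m ^+ 2 * T by rewrite mulr_ge0 ?sqr_ge0// ltW.
  rewrite /N; lra.
have X0 : 0 <= X by rewrite divr_ge0 ?ltW//; lra.
pose sig := Num.min (s1 * expR (- X)) a.
have sig0 : 0 < sig by rewrite lt_min a0 andbT mulr_gt0// expR_gt0.
have siga : sig <= a by rewrite ge_min lexx orbT.
have sigX : sig <= s1 * expR (- X) by rewrite ge_min lexx.
have sigs1 : sig <= s1.
  apply: le_trans sigX _; rewrite ler_piMr ?(ltW s10)//.
  by rewrite -[leRHS]expR0 ler_expR; lra.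
have lnsig : kk * (ln s1 - ln sig) > N.
  have : ln sig <= ln s1 - X.
    rewrite -[- X]expRK -lnM ?posrE ?expR_gt0// ler_ln ?posrE//.
    by rewrite mulr_gt0// expR_gt0.
  move=> h; have : kk * X <= kk * (ln s1 - ln sig) by rewrite ler_pM2l//; lra.
  have -> : kk * X = N + 1 by rewrite /X mulrC divfK// gt_eqF.
  lra.
have sig1 : sig <= 1 by lra.
pose eps := sig * Num.sqrt sig.
have eps0 : 0 < eps by rewrite mulr_gt0// sqrtr_gt0.
have epss : eps <= sig.
  rewrite /eps ler_piMr ?(ltW sig0)// -[leRHS]sqrtr1 ler_wsqrtr//.
have eps1 : eps <= 1 by lra.
pose M : R := 1 + slope_holder_bound T c e + a + osc_bound T e.
have M1 : 1 <= M by rewrite /M; lra.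
have aM : eps <= a <= M by rewrite /M; apply/andP; split; lra.
pose g := tame p eps M.
have ga : g a = m by rewrite /g tameE.
have Dg := tame_der p eps0 eps1 M1.
have cg : continuous g := der_continuous Dg.
have eta0 : 0 < p * (M `^ (p + 1))^-1 by rewrite mulr_gt0 ?invr_gt0 ?powR_gt0//;
  lra.
have cEE := continuous_forcing e_loc.
have [u [z [pu Du Dz]]] := @semilinear_existence R T c m E T0 cEE pE g _ _ cg
  eta0 (tame_slopes pp eps0 eps1 M1).
have lb : forall t, eps < u t.
  have DM : 1 + slope_holder_bound T c e <= M by rewrite /M; lra.
  apply: (positivity_of_minimum m0 sig0 sig1 _
    (erefl _) eps1 DM lnsig pu Du Dz); first by lra.
  by exists a.
have ub t : u t <= M.
  have [_ [s _ hs]] := momentum_mean T0 pE pu Du Dz.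
  have us : u s <= a by apply: (tame_le_reflect pp eps0 eps1 M1);
    rewrite -/g ga; lra.
  have cG : continuous (fun t => m - g (u t)).
    by apply: continuous_sub; [exact: continuous_const|apply: continuous_compose
      => //; exact: der_continuous Du].
  have := oscillation T0 e_loc pE pu Du Dz cG (monotone_force u Dg
    (dtame_le0 eps M pp) ga) s t.
  by have := ler_norm (u t - u s); rewrite /M; lra.
exists u; split => //; first by move=> t; exact: lt_trans (lb t).
exists z; split; first exact: Du.
by move=> t; apply: der_eq (Dz t) _; rewrite /g tameE// ub ltW.
Qed.

(** The force cannot exceed m everywhere, so u >= a somewhere; the oscillation
    bound does the rest. *)
Lemma solution_lower m a u : 0 < a -> (a `^ p)^-1 = m ->
  classical_solution T p c E m u ->
  forall t, a - osc_bound T e <= u t.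
Proof.
move=> a0 am [pos pu [z [Du Dz]]] t; have pp := p_gt0.
have cu := der_continuous Du.
have ch : continuous (fun t => m - (u t `^ p)^-1).
  by apply: continuous_sub; [exact: continuous_const|exact: continuous_invpow].
have uh s : 0 <= (u s - a) * (m - (u s `^ p)^-1).
  rewrite -am; have [h|h] := orP (le_total (u s) a).
    by rewrite mulr_le0// subr_le0// invpow_le.
  by rewrite mulr_ge0// subr_ge0// invpow_le.
have [[s _ hs] _] := momentum_mean T0 pE pu Du Dz.
have us : a <= u s.
  by rewrite leNgt; apply/negP => h; have := invpow_lt pp (pos s) h; rewrite am;
    lra.
have := oscillation T0 e_loc pE pu Du Dz ch uh t s.
by have := ler_norm (u s - u t); lra.
Qed.

(** Multiply z' by u and integrate by parts: the integral of m u is that of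
    u^(1 - p) + u' E - u'^2. Here u^(1 - p) <= 1 + u since 0 <= 1 - p <= 1, and
    u' E - u'^2 <= E^2 / 4. *)
Lemma solution_mean_bound m u : p <= 1 -> classical_solution T p c E m u ->
  m * prim u T <= T + prim u T + 4^-1 * prim (fun t => E t ^+ 2) T.
Proof.
move=> p1 [pos pu [z [Du Dz]]].
have cu := der_continuous Du; have cz := der_continuous Dz.
have pz := momentum_periodic pE pu Du.
have ch : continuous (fun t => m - (u t `^ p)^-1).
  by apply: continuous_sub; [exact: continuous_const|exact: continuous_invpow].
pose du t := z t + E t - c * u t.
have cdu' : continuous du by exact: (continuous_slope e_loc Du Dz).
pose W t := u t * z t - c / 2 * (u t * u t).
pose dW t := du t * z t + u t * (m - (u t `^ p)^-1) - c * (u t * du t).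
have DW : derives W dW.
  move=> t; apply: der_eq (derB (derM (Du t) (Dz t)) (derZ (c / 2) (derM (Du t)
    (Du t)))) _.
  by rewrite /dW -/(du t); set y := (u t `^ p)^-1; field.
have cdW : continuous dW.
  apply: continuous_sub; last by apply: continuous_scale; exact: continuous_mul.
  by apply: continuous_add; apply: continuous_mul.
have l1 := continuous_locint cdW.
have lE : locint (fun t => E t ^+ 2)
  by exact/continuous_locint/continuous_sqr/continuous_forcing.
have lu := continuous_locint cu.
have lc : locint (fun=> 1 : R) by apply/continuous_locint/continuous_const.
have l2 : locint (fun t => 1 + u t) by exact: locintD.
have l3 : locint (fun t => 4^-1 * E t ^+ 2 + dW t) by apply: locintD => //;
  exact: locintZ.
have pointwise x : m * u x <= (1 + u x) + (4^-1 * E x ^+ 2 + dW x).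
  rewrite /dW.
  have -> : z x = du x + c * u x - E x by rewrite /du; ring.
  have : u x * (u x `^ p)^-1 <= 1 + u x.
    have ux := pos x; rewrite -powRN -[X in X * _]powRr1 ?(ltW ux)// -powRD;
      last by apply/implyP => _; rewrite gt_eqF.
    have [h|h] := leP (u x) 1.
      apply: (@le_trans _ _ 1); last by have := pos x; lra.
      rewrite -[leRHS](powRr0 (u x)); apply: ger_powR; first by rewrite pos.
      lra.
    apply: (@le_trans _ _ (u x)); last by lra.
    rewrite -[leRHS]powRr1 ?(ltW (pos x))//; apply: ler_powR; first exact: ltW.
    by have := p_gt0; lra.
  set y := u x * _ => hy.
  have -> : u x * (m - (u x `^ p)^-1) = m * u x - y by rewrite /y; ring.
  by have := sqr_ge0 (du x - 2^-1 * E x); rewrite !expr2; lra.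
have := prim_le (locintZ m lu) (locintD l2 l3) (ltW T0) (fun x _ =>
  pointwise x).
rewrite !(primD _ l2 l3) !(primD _ lc lu) !(primD _
  (locintZ 4^-1 lE) l1) !(primZ _ _ lE) !(primZ _ _ lu).
rewrite !prim_cst !prim0.
have := @prim_der _ _ _ 0 T DW cdW; rewrite prim0.
have -> : W T = W 0 by rewrite /W -[in LHS](add0r T) pu pz.
set i1 := prim _ _; set i2 := prim _ _; lra.
Qed.

End Existence.

(** * The average along the branch of solutions *)

Section Branch.
Context {R : realType} (T p c : R) (e : R -> R).
Hypotheses (T0 : 0 < T) (p3 : 3^-1 <= p) (e_loc : locint e)
  (pE : periodic (prim e) T).
Implicit Types (m a b x y k r s t : R) (u v w : R -> R).
Local Notation sol := (classical_solution T p c (prim e)).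
Let pp := p_gt0 p3.

Lemma averageE u : continuous u -> average T u = T^-1 * prim u T.
Proof. by move=> cu; rewrite /average primE// ltW. Qed.

Lemma average_le u v k : continuous u -> continuous v ->
  (forall t, u t <= v t + k) ->
  average T u <= average T v + k.
Proof.
move=> cu cv uv; rewrite !averageE//.
have lu := continuous_locint cu; have lv := continuous_locint cv.
have lk : locint (fun=> k) by apply/continuous_locint/continuous_const.
have := prim_le lu (locintD lv lk) (ltW T0) (fun x _ => uv x).
rewrite !(primD _ lv lk) !prim_cst !prim0 mulr0 addr0 !subr0.
move=> h; have : T^-1 * prim u T <= T^-1 * (prim v T + k * T).
  by rewrite ler_pM2l ?invr_gt0//; lra.
by have -> : T^-1 * (prim v T + k * T) = T^-1 * prim v T + k by field;
  rewrite gt_eqF.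
Qed.

Lemma average_cst_le u k : continuous u -> (forall t, k <= u t) ->
  k <= average T u.
Proof.
move=> cu ku; rewrite averageE//.
have lk : locint (fun=> k) by apply/continuous_locint/continuous_const.
have := prim_le lk (continuous_locint cu) (ltW T0) (fun x _ => ku x).
rewrite !prim_cst !prim0 mulr0 !subr0 => h.
by rewrite mulrC ler_pdivlMr.
Qed.

Lemma average_inj m1 m2 u1 u2 : sol m1 u1 -> sol m2 u2 ->
  average T u1 = average T u2 ->
  u1 = u2 /\ m1 = m2.
Proof.
move=> s1 s2; rewrite (averageE (solution_continuous s1)) (averageE
  (solution_continuous s2)) => h.
apply: (solution_prim_inj T0 pp s1 s2); apply: mulfI h.
by rewrite invr_eq0 gt_eqF.
Qed.

Lemma average_decreasing m1 m2 u1 u2 : sol m1 u1 -> sol m2 u2 -> m1 < m2 ->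
  average T u2 < average T u1.
Proof.
move=> s1 s2 m12; rewrite lt_neqAle; apply/andP; split.
  apply/eqP => h; have [_ E12] := average_inj s2 s1 h.
  by move: m12; rewrite E12 ltxx.
rewrite -[leRHS]addr0; apply: (average_le (solution_continuous s2)
  (solution_continuous s1)).
by move=> t; rewrite addr0; exact: (solution_antitone T0 pp s1 s2 (ltW m12)).
Qed.

Lemma average_gt0 m u : sol m u -> 0 < average T u.
Proof.
move=> s; have cu := solution_continuous s; move: (s) => [pos pu _].
have [b b0 bu] := periodic_gt0_lb T0 cu pu pos.
exact: lt_le_trans b0 (average_cst_le cu bu).
Qed.

Lemma average_near m u k : sol m u -> 0 < k -> exists2 eta, 0 < eta &
  forall m' u', sol m' u' -> `|m' - m| < eta ->
    `|average T u' - average T u| <= k.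
Proof.
move=> s k0; have [eta eta0 H] := solution_near T0 pp s k0.
exists eta => // m' u' s' h.
have cu := solution_continuous s; have cu' := solution_continuous s'.
have A : average T u' <= average T u + k.
  by apply: average_le => // t; have := H _ _ s' h t;
    rewrite ler_norml => /andP[_]; lra.
have B : average T u <= average T u' + k.
  by apply: average_le => // t; have := H _ _ s' h t;
    rewrite ler_norml => /andP[h1 _]; lra.
by rewrite ler_norml; apply/andP; split; lra.
Qed.

(** Take m = a^-p with a larger than X by more than the oscillation. *)
Lemma average_unbounded X : exists2 m, 0 < m & forall u, sol m u ->
  X < average T u.
Proof.
have oK0 : 0 <= osc_bound T e by rewrite mulr_ge0 ?sqrtr_ge0//;
  have := slope_bound_ge0 T0 e_loc; lra.
pose a := `|X| + osc_bound T e + 1.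
have a0 : 0 < a by rewrite /a; have := normr_ge0 X; lra.
exists ((a `^ p)^-1); first by rewrite invr_gt0 powR_gt0.
move=> u s; have cu := solution_continuous s.
have := average_cst_le cu (solution_lower T0 p3 e_loc pE a0 (erefl _) s).
by rewrite /a; have := ler_norm X; lra.
Qed.

End Branch.

(** * The curve *)

Section BranchCurve.
Context {R : realType} (xi : R -> R).
Implicit Types (m a b x y : R).
Hypotheses (xi_dec : forall a b, 0 < a -> a < b -> xi b < xi a)
  (xi_gt0 : forall a, 0 < a -> 0 < xi a)
  (xi_cont : forall a, 0 < a -> {for a, continuous xi})
  (xi_unb : forall X, exists2 m, 0 < m & X < xi m).

(** A continuous, strictly decreasing, positive function xi on (0, +oo) that is
    unbounded near 0 maps (0, +oo) onto (inf xi, +oo); phi is the inverse. *)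
Lemma inverse_branch : exists (xi0 : R) (phi : R -> R),
  [/\ 0 <= xi0, forall m, 0 < m -> xi0 < xi m,
      forall x, xi0 < x -> 0 < phi x /\ xi (phi x) = x,
      {in `]xi0, +oo[, continuous phi} /\ {in `]xi0, +oo[ &,
        {homo phi : x y /~ x < y}}
    & phi x @[x --> xi0^'+] --> +oo /\ phi x @[x --> +oo] --> (0 : R)].
Proof.
pose S : set R := [set xi m | m in [set m | 0 < m]].
have S0 : S !=set0 by exists (xi 1), 1 => //=.
have lbS : lbound S 0 by move=> _ [m m0 <-]; exact/ltW/xi_gt0.
have hS : has_inf S by split => //; exists 0.
pose xi0 := inf S.
have xi00 : 0 <= xi0 by exact: lb_le_inf.
have xi0m m : 0 < m -> xi0 < xi m.
  move=> m0; have m1 : 0 < m + 1 by rewrite addr_gt0.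
  apply: (@le_lt_trans _ _ (xi (m + 1))); last by apply: xi_dec => //;
    rewrite ltrDl.
  by apply: ge_inf; [case: hS|exists (m + 1)].
have xi_le a b : 0 < a -> 0 < b -> xi a < xi b -> b < a.
  move=> a0 b0 h; rewrite ltNge le_eqVlt; apply/negP => /orP[/eqP E|ab].
    by move: h; rewrite E ltxx.
  by have := xi_dec a0 ab; rewrite ltNge (ltW h).
have surj x : xi0 < x -> exists m, 0 < m /\ xi m = x.
  move=> xx.
  have [_ [m1 m10 <-] m1x] := inf_lt S0 xx.
  have [m2 m20 m2x] := xi_unb x.
  have m21 : m2 < m1 by apply: xi_le => //; exact: lt_trans m2x.
  have [||m] := @IVT R xi m2 m1 x (ltW m21).
  - apply: continuous_in_subspaceT => y; rewrite inE/= in_itv/= => /andP[h _].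
    by apply: xi_cont; exact: lt_le_trans h.
  - by rewrite ge_min le_max (ltW m1x) (ltW m2x) orbT.
  - rewrite in_itv/= => /andP[h _] E; exists m; split => //;
      exact: lt_le_trans h.
have [phi phiP] : exists phi : R -> R, forall x, xi0 < x ->
  0 < phi x /\ xi (phi x) = x.
  have : forall x, exists m, xi0 < x -> 0 < m /\ xi m = x.
    move=> x; have [h|h] := ltP xi0 x; last by exists 0.
    by have [m mP] := surj x h; exists m.
  by move=> /choice[phi Hphi]; exists phi.
have phi_gt x m : xi0 < x -> 0 < m -> x < xi m -> m < phi x.
  by move=> h m0 hx; have [p0 pE] := phiP x h; apply: xi_le => //; rewrite pE.
have phi_lt x m : xi0 < x -> 0 < m -> xi m < x -> phi x < m.
  by move=> h m0 hx; have [p0 pE] := phiP x h; apply: xi_le => //; rewrite pE.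
exists xi0, phi; split => //; split.
- move=> x; rewrite in_itv/= andbT => hx.
  have [m0 mE] := phiP x hx; set m := phi x in m0 mE *.
  apply/cvgrPdist_le => /= eps eps0.
  (* The bound by m / 2 keeps m - d positive. *)
  pose d := Num.min eps (m / 2).
  have d0 : 0 < d by rewrite lt_min eps0 divr_gt0.
  have de : d <= eps by rewrite ge_min lexx.
  have dm : d <= m / 2 by rewrite ge_min lexx orbT.
  have a0 : 0 < m - d by lra.
  have b0 : 0 < m + d by lra.
  have h1 : x < xi (m - d) by rewrite -mE; apply: xi_dec => //; lra.
  have h2 : xi (m + d) < x by rewrite -mE; apply: xi_dec => //; lra.
  near=> y.
  have y1 : y < xi (m - d) by near: y; exact: lt_nbhsl.
  have y2 : xi (m + d) < y by near: y; exact: lt_nbhsr.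
  have hy : xi0 < y by apply: lt_trans y2; exact: xi0m.
  have := phi_gt y _ hy a0 y1; have := phi_lt y _ hy b0 y2 => k1 k2.
  by rewrite -/m ler_norml; apply/andP; split; lra.
- move=> x y; rewrite !in_itv/= !andbT => hx hy xy.
  have [p0 pE] := phiP y hy.
  by apply: phi_lt => //; rewrite pE.
- apply/cvgryPge => A; pose m := Num.max A 1.
  have m0 : 0 < m by rewrite lt_max ltr01 orbT.
  near=> x; apply: (@le_trans _ _ m); first by rewrite le_max lexx.
  have h1 : xi0 < x by near: x; exact: nbhs_right_gt.
  have h2 : x < xi m by near: x; apply: nbhs_right_lt; exact: xi0m.
  exact/ltW/phi_gt.
- apply/cvgrPdist_le => /= eps eps0; near=> x.
  have hx : xi eps < x by near: x; apply: nbhs_pinfty_gt; rewrite num_real.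
  have h0 : xi0 < x by apply: lt_trans hx; exact: xi0m.
  have [p0 pE] := phiP x h0; have := phi_lt x _ h0 eps0 hx => h.
  by rewrite sub0r normrN gtr0_norm// ltW.
Unshelve. all: by end_near. Qed.

End BranchCurve.

Theorem theorem4p2 (R : realType) (T p c : R) (e : R -> R)
  (T_gt0 : 0 < T) (p_ge : 3^-1 <= p)
  (e_periodic : periodic e T)
  (e_L2 : L2_on `]0, T[ e)
  (e_mean0 : \int[@lebesgue_measure R]_(t in `]0, T[) e t = 0) :
  [/\ forall mu : R,
        (exists! u : R -> R, positive_solution T p c e mu u) <-> 0 < mu,
      forall (u1 u2 : R -> R) (mu1 mu2 : R),
        positive_solution T p c e mu1 u1 ->
        positive_solution T p c e mu2 u2 ->
        average T u1 = average T u2 -> u1 = u2 /\ mu1 = mu2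
    & exists (xi0 : R) (phi : R -> R),
      [/\ 0 <= xi0,
          [set z : R * R | exists u : R -> R,
             positive_solution T p c e z.2 u /\ z.1 = average T u] =
          [set z : R * R | xi0 < z.1 /\ z.2 = phi z.1],
          {in `]xi0, +oo[, continuous phi} /\
          {in `]xi0, +oo[ &, {homo phi : x y /~ x < y}},
          phi x @[x --> xi0^'+] --> +oo /\ phi x @[x --> +oo] --> (0 : R)
        & p <= 1 -> xi0 = 0]].

Proof.
have [e_loc e2_loc] := L2_on_locint T_gt0 e_periodic e_L2.
have eT : prim e T = 0.
  rewrite primE ?(ltW T_gt0)//.
  have i1 : (@lebesgue_measure R).-integrable `]0, T] (EFin \o e).
    by apply: integrableS (locint_integrable 0 T e_loc) => //;
      exact: subset_itv_oc_cc.
  have i2 : (@lebesgue_measure R).-integrable `]0, T[ (EFin \o e).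
    by apply: integrableS (locint_integrable 0 T e_loc) => //;
      exact: subset_itv_oo_cc.
  by rewrite -Rintegral_itv_obnd_cbnd// -Rintegral_itv_bndo_bndc.
have pE := prim_periodic T_gt0 e_periodic e_loc eT.
have solP m u : positive_solution T p c e m u <-> classical_solution T p c
  (prim e) m u.
  by split; [exact: positive_to_classical|exact: classical_to_positive].
have pp := p_gt0 p_ge.
have ex m (m0 : 0 < m) := existence c T_gt0 p_ge e_loc e2_loc pE m0.
split.
- move=> mu; split.
    by move=> [u [/solP s _]]; exact: (solution_mu_gt0 T_gt0 pE s).
  move=> /ex[u s]; exists u; split; first exact/solP.
  by move=> v /solP s'; exact: (solution_unique T_gt0 pp s s').
- move=> u1 u2 m1 m2 /solP s1 /solP s2; exact: (average_inj T_gt0 p_ge s1 s2).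
have [U HU] : exists U : R -> R -> R, forall m, 0 < m ->
  classical_solution T p c (prim e) m (U m).
  have : forall m, exists u, 0 < m -> classical_solution T p c (prim e) m u.
    move=> m; have [m0|m0] := ltP 0 m; first by have [u s] := ex m m0; exists u.
    by exists (fun=> 0).
  by move=> /choice[U HU]; exists U.
pose xi m := average T (U m).
have [||||xi0 [phi [xi00 xi0m phiP Hcont Hlim]]] := @inverse_branch R xi.
- move=> a b a0 ab; apply: (average_decreasing T_gt0 p_ge (HU _ a0)
    (HU _ _) ab).
  exact: lt_trans ab.
- by move=> a a0; exact: (average_gt0 T_gt0 (HU _ a0)).
- move=> a a0; apply/cvgrPdist_le => /= eps eps0.
  have [eta eta0 H] := average_near T_gt0 p_ge (HU _ a0) eps0.
  near=> b; rewrite distrC; apply: H.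
    by apply: HU; near: b; exact: lt_nbhsr.
  by near: b; exists eta => //= y; rewrite distrC.
- move=> X; have [m m0 H] := average_unbounded c T_gt0 p_ge e_loc pE X.
  by exists m => //; apply: H; exact: HU.
exists xi0, phi; split => //.
- apply/seteqP; split => -[x m] /=.
    move=> [u [/solP s xE]].
    have m0 := solution_mu_gt0 T_gt0 pE s.
    have uE := solution_unique T_gt0 pp s (HU _ m0).
    have xE' : x = xi m by rewrite xE uE.
    have hx : xi0 < x by rewrite xE'; exact: xi0m.
    have [f0 fE] := phiP x hx; split => //.
    by have [] := average_inj T_gt0 p_ge (HU _ m0) (HU _ f0) (etrans (esym xE')
      (esym fE)).
  move=> [hx ->]; have [f0 fE] := phiP x hx.
  by exists (U (phi x)); split; [apply/solP; exact: HU|exact: esym fE].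
- move=> p1; apply/eqP; rewrite eq_le xi00 andbT leNgt; apply/negP => x0.
  have xT0 : 0 < xi0 * T by rewrite mulr_gt0.
  pose K := `|T + 4^-1 * prim (fun t => prim e t ^+ 2) T|.
  (* For this m the bound (m - 1) xi0 T <= K fails. *)
  pose m := 1 + (K + 1) / (xi0 * T).
  have q0 : 0 < (K + 1) / (xi0 * T) by rewrite divr_gt0//;
    have := normr_ge0 (T + 4^-1 * prim (fun t => prim e t ^+ 2) T); rewrite -/K;
    lra.
  have m0 : 0 < m by rewrite addr_gt0.
  have s := HU _ m0.
  have mass := solution_mean_bound T_gt0 p_ge e_loc pE p1 s.
  have : xi0 * T < prim (U m) T.
    have := xi0m _ m0; rewrite /xi (averageE T_gt0 (solution_continuous s)).
    by rewrite mulrC ltr_pdivlMr.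
  have := ler_norm (T + 4^-1 * prim (fun t => prim e t ^+ 2) T); rewrite -/K.
  set P := prim (U m) T in mass * => h1 h2.
  have : (K + 1) / (xi0 * T) * (xi0 * T) <= (K + 1) / (xi0 * T) * P
    by rewrite ler_pM2l// ltW.
  rewrite divfK ?gt_eqF//; rewrite /m in mass; lra.
Unshelve. all: by end_near. Qed.
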